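(* Let $\delta\in(0,1)$, let $r>0$, and let $S$ be a Poisson process on $[T_1,T_2]$ with (deterministic) intensity function $\lambda(t)$. Denote $\Lambda(t)=\int_{T_1}^{t}\lambda(s)\,ds$. For an integer $k\ge 0$, let $\bm{U}=(U_1,\dots,U_k)$ be a vector of $k$ ordered uniform random variables in $[0,\Lambda(T_2)]$ (i.e. the order statistics $U_1\le\dots\le U_k$ of $k$ independent uniform random variables on $[0,\Lambda(T_2)]$), and denote $U_0=0$, $U_{k+1}=\Lambda(T_2)$. Let $G=\prod_{i=1}^{k+1}(U_i-U_{i-1})$ and $C_k=F_G^{-1}(\delta)$, where $F_G$ is the cumulative distribution function of $G$. Then, using the ILR depth, for any cardinality $k\ (\ge 0)$ the threshold $t_k$ at level $\delta$, i.e. the number $t_k$ satisfying $P\big(D(\bm{s}_0;\lambda)<t_k\big)=\delta$ for a random realization $\bm{s}_0$ of the process with cardinality $k$, is given by $$t_k=\frac{w(k;P_{|S|})^r}{1-\log\bigg(C_k\cdot\Big(\frac{k+1}{\Lambda(T_2)}\Big)^{k+1}\bigg)}.$$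
   Context: A spike train on the time domain $[T_1,T_2]$ with cardinality $k\ge 0$ is a vector $\bm{s}=(s_1,\dots,s_k)$ of event times in $[T_1,T_2]$ in increasing order; $|\bm{s}|=k$ denotes its cardinality (number of events). A Poisson process $S$ on $[T_1,T_2]$ with intensity $\lambda\ge 0$ is viewed as a random spike train, with $0<\Lambda(T_2)<\infty$, where $\Lambda(t)=\int_{T_1}^t\lambda(u)\,du$. $P_{|S|}$ denotes the probability distribution of the cardinality $|S|$. Normalized depth of the cardinality: for an integer $k\ge 0$ put $D_1(k;P_{|S|})=\min\{P_{|S|}(|S|\le k),\,P_{|S|}(|S|\ge k)\}$ and $w(k;P_{|S|})=\dfrac{D_1(k;P_{|S|})}{\max_{j} D_1(j;P_{|S|})}$. ILR depth conditioned on cardinality: for a spike train $\bm{s}=(s_1,\dots,s_k)$, with $s_0=T_1$ and $s_{k+1}=T_2$, $$D_{\lambda-ILR}(\bm{s}\mid |\bm{s}|=k)=\frac{1}{1-\log\Big(\frac{(k+1)^{k+1}}{\Lambda(T_2)^{k+1}}\prod_{i=1}^{k+1}\big(\Lambda(s_i)-\Lambda(s_{i-1})\big)\Big)}.$$ Spike train depth (with hyper-parameter $r>0$), using the ILR depth as conditional depth: $$D(\bm{s};\lambda)=w(|\bm{s}|;P_{|S|})^r\,D_{\lambda-ILR}(\bm{s}\mid|\bm{s}|).$$ Outlier threshold: for a pre-specified $\delta\in(0,1)$, a spike train $\bm{s}_0$ with cardinality $k$ is declared a potential outlier if $D(\bm{s}_0;\lambda)<t_k$, where the threshold $t_k$ satisfies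 $P(D(\bm{s}_0;\lambda)<t_k)=\delta$, the probability being over a random realization $\bm{s}_0$ of the process with cardinality $k$ (i.e. conditioned on $|S|=k$).
   Formalization: For k=0 the depth given |S|=0 is the constant w(0)^r, so no t has P(D<t)=δ; that the formula satisfies this equation is therefore claimed only for k≥1, while for all k≥0 any solution equals the formula and the formula is the δ-quantile of the conditional depth. *)

(* Defs.v *)
From HB Require Import structures.
From mathcomp Require Export all_boot all_order all_algebra.
From mathcomp Require Export all_classical all_reals all_analysis.
Import Order.TTheory GRing.Theory Num.Theory.
Import numFieldNormedType.Exports.

Set Implicit Arguments.
Unset Strict Implicit.
Unset Printing Implicit Defensive.

Local Open Scope classical_set_scope.
Local Open Scope ring_scope.

Section probability.
Context d (Omega : measurableType d) (R : realType).
Variable P : probability Omega R.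

(* The product rule over subfamilies is the case where the other [A i] are
   [setT]. *)
Definition mutually_independent d' (T : measurableType d') (I : finType)
    (X : I -> Omega -> T) : Prop :=
  forall A : I -> set T, (forall i, measurable (A i)) ->
    P (\bigcap_i (X i @^-1` A i)) = (\prod_(i : I) P (X i @^-1` A i))%E.

Definition cond_prob (A B : set Omega) : R :=
  fine (P (A `&` B)) / fine (P B).

(* [cdf], for a function that is not packaged as a random variable *)
Definition dist_fun (X : Omega -> R) (x : R) : R :=
  fine (P [set w | X w <= x]).

End probability.

(* F^{-1}(p) for a cumulative distribution function F *)
Definition quantile (R : realType) (F : R -> R) (p : R) : R :=
  inf [set x | p <= F x].

Section spike_trains.
Context {R : realType}.
Implicit Types (s x : seq R) (lambda : R -> R).

Definition spike_train (T1 T2 : R) s : bool :=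
  sorted <=%R s && all (fun t => T1 <= t <= T2) s.

Definition nb_events s (a b : R) : nat := count (fun t => a < t <= b) s.

Definition cumulative (T1 : R) lambda (t : R) : R :=
  \int[lebesgue_measure]_(u in `[T1, t]) lambda u.

Definition is_intensity (T1 T2 : R) lambda : Prop :=
  (forall t, T1 <= t <= T2 -> 0 <= lambda t) /\
  lebesgue_measure.-integrable `[T1, T2] (EFin \o lambda).

Definition spacings_prod x : R :=
  \prod_(i < (size x).-1) (x`_i.+1 - x`_i).

End spike_trains.

Section poisson_process.
Context {R : realType} d (Omega : measurableType d).
Variables (T1 T2 : R) (P : probability Omega R).

Definition random_spike_train (S : Omega -> seq R) : Prop :=
  (forall w, spike_train T1 T2 (S w)) /\
  (forall t n, measurable [set w | count (fun u => u <= t) (S w) = n]).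

(* The intervals ]a, b] miss T1, hence the second clause.
   The second argument of [poisson_prob] is a dummy; [poisson_prob 0 _] is the
   Dirac mass at 0. *)
Definition poisson_process (lambda : R -> R) (S : Omega -> seq R) : Prop :=
  let Lambda := cumulative T1 lambda in
  [/\ random_spike_train S,
      {ae P, forall w, T1 \notin S w},
      forall a b, T1 <= a -> a <= b -> b <= T2 -> forall A : set nat,
        pushforward P (fun w => nb_events (S w) a b) A =
        poisson_prob (Lambda b - Lambda a) 0 A &
      forall (n : nat) (t : nat -> R),
        nondecreasing_seq t -> (forall i, T1 <= t i <= T2) ->
        mutually_independent P
          (fun (i : 'I_n) w => nb_events (S w) (t i) (t i.+1))].

End poisson_process.

Section depth.
Context {R : realType}.
Implicit Types (mu : set nat -> \bar R) (lambda : R -> R).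

Definition card_depth mu (k : nat) : R :=
  Num.min (fine (mu [set j | (j <= k)%N])) (fine (mu [set j | (k <= j)%N])).

Definition norm_card_depth mu (k : nat) : R :=
  card_depth mu k / sup (range (card_depth mu)).

(* Extended logarithm and inverse: the depth is 0 when a factor vanishes
   (log 0 = -oo), whereas the real-valued [ln] has [ln 0 = 0]. *)
Definition ilr_depth (T1 T2 : R) lambda (s : seq R) : R :=
  let Lambda := cumulative T1 lambda in
  let k := size s in
  let prod := spacings_prod (map Lambda (T1 :: rcons s T2)) in
  fine ((1 - lne (k.+1%:R ^+ k.+1 / Lambda T2 ^+ k.+1 * prod)%R%:E)^-1)%E.

Definition spike_train_depth (T1 T2 : R) lambda mu (r : R) (s : seq R) : R :=
  norm_card_depth mu (size s) `^ r * ilr_depth T1 T2 lambda s.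

End depth.

(* U_1 <= ... <= U_k *)
Definition order_statistics (R : realType) (Omega : Type) (k : nat)
    (V : 'I_k -> Omega -> R) (w : Omega) : seq R :=
  sort <=%R [seq V i w | i <- enum 'I_k].

(* Main.v *)
(* Idea.  Conditionally on |S| = k, the points Lambda(s_i) are distributed like
   the order statistics of k uniform variables on [0, L], L = Lambda(T2).  Only
   the law of the product of the spacings is needed, so both samples are
   discretized: cut [0, L] into n cells of equal length and record the cell of
   each point.  The number of points per cell is Poisson on one side and
   multinomial on the other, hence the two lists of cells have the same law, and
   they determine the product of the spacings up to O(1/n).
   On [0, (L/(k+1))^(k+1)], which is the range of the product G by AM-GM, the
   depth is a strictly increasing function of G.  For k > 0 the law of G has no
   atoms, since G is a quadratic polynomial in the largest point once the other
   points are fixed, and it charges every open subinterval of that range; so its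
   quantile is its only solution of P(G < u) = delta.  For k = 0, G is constant
   and P(D < t) only takes the values 0 and 1. *)
Require Import Defs.
From mathcomp Require Import measurable_realfun ring lra zify.
Import Order.TTheory GRing.Theory Num.Theory.
Import numFieldNormedType.Exports.
Set Implicit Arguments.
Unset Strict Implicit.
Unset Printing Implicit Defensive.
Local Open Scope classical_set_scope.
Local Open Scope ring_scope.

(** * Permutations, spacings and cells *)

(** The process is known only through counts on intervals ]a, b], and [Lambda] is constant wherever
    the intensity vanishes, so it may have no inverse with which to change time. The cells are
    therefore cut on the time axis, at chosen preimages of the levels j L / n, and only their images
    under [Lambda] are compared with the cells of [0, L]. A sorted list of cells is determined by
    its multiplicities. Equality of the two laws then reduces to counting the distinct permutations
    of a list, which is the multinomial coefficient. This equality is exact for every n, up to the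
    factor P(|S| = k), and the discretization error is a deterministic bound. Hence comparing levels
    c and c + e and letting e tend to 0, by continuity of measures, gives equal distribution
    functions at every c, including possible atoms. Cells are open on the left, so both sides are
    restricted to events of full probability: no event at T1, and all sample points in ]0, L]. *)

(** Split the permutations by their first element [x]: the rest is a permutation of [rem x s], and
    the multiplicity of [x] in [s] is the factor that turns the factorial for [rem x s] into the one
    for [s]. *)
Lemma size_permutations_count (T : finType) (s : seq T) :
  (size (permutations s) * \prod_(x : T) (count_mem x s)`! = (size s)`!)%N.
Proof.
elim: {s}(size s) {-2}s (erefl (size s)) => [|n IHn] s sn.
  by move/size0nil: sn => ->; rewrite big1.
have s_gt0 : (0 < size s)%N by rewrite sn.
rewrite (perm_size (permutationsE s_gt0)) size_allpairs_dep sumnE big_map.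
rewrite big_distrl/=.
transitivity (\sum_(x <- undup s) count_mem x s * n`!)%N.
  apply: eq_big_seq => x; rewrite mem_undup => xs.
  have srem : size (rem x s) = n by rewrite size_rem// sn.
  rewrite -srem -(IHn _ srem) mulnCA; congr muln.
  rewrite (bigD1 x)//= [in RHS](bigD1 x)//= mulnA.
  congr muln; last first.
    apply: eq_bigr => y yx; congr (_ `!).
    by rewrite (permP (perm_to_rem xs))/= eq_sym (negbTE yx).
  by rewrite (permP (perm_to_rem xs))/= eqxx add1n factS.
rewrite -big_distrl/= sn factS -sn; congr muln.
rewrite -[RHS](perm_size (perm_count_undup s)) size_flatten /shape -map_comp.
by rewrite sumnE big_map; apply: eq_bigr => x _ /=; rewrite size_nseq.
Qed.

Section spacings.
Context {R : realType}.
Implicit Types (x y : seq R) (L e : R).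

Lemma spacings_prodE L x : spacings_prod (0 :: rcons x L) =
  \prod_(i < (size x).+1) ((0 :: rcons x L)`_i.+1 - (0 :: rcons x L)`_i).
Proof. by rewrite /spacings_prod/= size_rcons. Qed.

Lemma spacings_prod_rcons x (b : R) : (0 < size x)%N ->
  spacings_prod (rcons x b) = spacings_prod x * (b - last 0 x).
Proof.
move=> x0; rewrite /spacings_prod size_rcons/=.
rewrite -[in LHS](prednK x0) big_ord_recr/= prednK//; congr (_ * _).
  apply: eq_bigr => i _; rewrite !nth_rcons.
  by have := ltn_ord i; case: ifPn; case: ifPn => //; lia.
by rewrite !nth_rcons eqxx ltnn ltn_predL x0 nth_last.
Qed.

Lemma spacings_prod_ge0 L x : sorted <=%R (0 :: rcons x L) ->
  0 <= spacings_prod (0 :: rcons x L).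
Proof.
move=> s; rewrite spacings_prodE; apply: prodr_ge0 => i _; rewrite subr_ge0.
by apply: (sorted_leq_nth le_trans le_refl) => //;
  rewrite inE/= size_rcons; have := ltn_ord i; lia.
Qed.

Lemma spacings_prod_le L x : sorted <=%R (0 :: rcons x L) ->
  spacings_prod (0 :: rcons x L) <= (L / (size x).+1%:R) ^+ (size x).+1.
Proof.
move=> s; rewrite spacings_prodE.
set E := fun i : 'I_(size x).+1 =>
  (0 :: rcons x L)`_i.+1 - (0 :: rcons x L)`_i.
have E0 i : i \in 'I_(size x).+1 -> 0 <= E i.
  move=> _; rewrite subr_ge0.
  by apply: (sorted_leq_nth le_trans le_refl) => //;
    rewrite inE/= size_rcons; have := ltn_ord i; lia.
have [+ _] := leif_AGM E0; rewrite card_ord.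
congr (_ <= (_ / _) ^+ _); rewrite /E.
rewrite -(big_mkord xpredT (fun i => (0 :: rcons x L)`_i.+1 - (0 :: rcons x L)`_i)).
by rewrite telescope_sumr//= nth_rcons ltnn eqxx subr0.
Qed.

(** Replace one factor at a time: A a - B b = (A - B) a + B (a - b). The assumption [1 <= M] absorbs
    the lower power of [M] left by the second term. *)
Lemma prod_close n (a b : nat -> R) (M e : R) : 1 <= M ->
  (forall i, (i < n)%N -> `|a i| <= M) -> (forall i, (i < n)%N -> `|b i| <= M) ->
  (forall i, (i < n)%N -> `|a i - b i| <= e) ->
  `|\prod_(i < n) a i - \prod_(i < n) b i| <= n%:R * M ^+ n * e.
Proof.
move=> M1; have M0 : 0 <= M by apply: le_trans M1.
elim: n => [|n IHn] aM bM abe; first by rewrite !big_ord0 subrr normr0 !mul0r.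
have {}IHn := IHn (fun i h => aM i (ltnW h)) (fun i h => bM i (ltnW h))
  (fun i h => abe i (ltnW h)).
have e0 : 0 <= e by exact: le_trans (normr_ge0 _) (abe 0%N isT).
have bn : `|\prod_(i < n) b i| <= M ^+ n.
  have -> : M ^+ n = \prod_(i < n) M by rewrite prodr_const card_ord.
  by rewrite normr_prod; apply: ler_prod => i _; rewrite normr_ge0 bM// ltnS ltnW.
rewrite !big_ord_recr/=.
set A := \prod_(i < n) a i in IHn *; set B := \prod_(i < n) b i in IHn bn *.
have -> : A * a n - B * b n = (A - B) * a n + B * (a n - b n) by ring.
apply: le_trans (ler_normD _ _) _; rewrite !normrM.
have h1 : `|A - B| * `|a n| <= n%:R * M ^+ n * e * M.
  by apply: ler_pM => //; exact: aM.
have h2 : `|B| * `|a n - b n| <= M ^+ n * M * e.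
  apply: ler_pM => //; last exact: abe.
  by apply: le_trans bn _; rewrite ler_peMr// exprn_ge0.
apply: le_trans (lerD h1 h2) _; rewrite -natr1 exprSr.
by rewrite le_eqVlt; apply/orP; left; apply/eqP; ring.
Qed.

(** Each spacing is at most L; [1 + L] is a bound that is also at least 1, as [prod_close] requires.
    The factor 2 is there because both ends of a spacing move by up to [e]. *)
Lemma spacings_prod_close L x y e : 0 <= L -> 0 <= e -> size x = size y ->
  all (fun u => 0 <= u <= L) x -> all (fun u => 0 <= u <= L) y ->
  (forall i, (i < size x)%N -> `|x`_i - y`_i| <= e) ->
  `|spacings_prod (0 :: rcons x L) - spacings_prod (0 :: rcons y L)| <=
  (size x).+1%:R * (1 + L) ^+ (size x).+1 * (2 * e).
Proof.
move=> L0 e0 xy xL yL xye; rewrite !spacings_prodE -xy.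
have bnd z i : all (fun u => 0 <= u <= L) z -> 0 <= (0 :: rcons z L)`_i <= L.
  move=> zL; case: i => [|i]/=; first by rewrite lexx.
  rewrite nth_rcons; case: ltnP => [iz|_]; first exact: (allP zL _ (mem_nth _ iz)).
  by case: eqP; rewrite lexx L0.
have close i : `|(0 :: rcons x L)`_i - (0 :: rcons y L)`_i| <= e.
  case: i => [|i]/=; first by rewrite subrr normr0.
  rewrite !nth_rcons -xy; case: ltnP => [|_]; first exact: xye.
  by case: eqP; rewrite subrr normr0.
have bnd2 z i : all (fun u => 0 <= u <= L) z ->
    `|(0 :: rcons z L)`_i.+1 - (0 :: rcons z L)`_i| <= 1 + L.
  move=> zL; have := bnd z i zL; have := bnd z i.+1 zL.
  by rewrite ler_norml; lra.
apply: (@prod_close _ (fun i => (0 :: rcons x L)`_i.+1 - (0 :: rcons x L)`_i)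
 (fun i => (0 :: rcons y L)`_i.+1 - (0 :: rcons y L)`_i)) => [|i _|i _|i _].
- by rewrite lerDl.
- exact: bnd2.
- exact: bnd2.
- have := close i; have := close i.+1; rewrite !ler_norml; lra.
Qed.

End spacings.

Section cells.
Context {R : realType}.
Variables (t : nat -> R) (m : nat).
Hypothesis t_nd : {homo t : i j / (i <= j)%N >-> i <= j}.
Implicit Types u v : R.

(* The index [j] such that [t j < u <= t j.+1], see [cell_in]; the values outside
   of ]t 0, t m.+1] are junk. *)
Definition cell u : 'I_m.+1 := inord (\sum_(i < m) (t i.+1 < u)%R).

Let cell_lt u : (\sum_(i < m) (t i.+1 < u)%R < m.+1)%N.
Proof.
rewrite ltnS -[leqRHS]card_ord -sum1_card; apply: leq_sum => i _.
by case: (_ < _).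
Qed.

Lemma cell_homo : {homo cell : u v / u <= v >-> (u <= v)%O}.
Proof.
move=> u v uv; rewrite leEord/= !inordK//; apply: leq_sum => i _.
by case: (ltP (t i.+1) u) => // /lt_le_trans -> //.
Qed.

(** By monotonicity of [t], the indices counted by [cell] are exactly those below [j]. *)
Lemma cell_eq u (j : 'I_m.+1) : t j < u <= t j.+1 -> cell u = j.
Proof.
move=> /andP[tju utj]; apply/val_inj; rewrite /= inordK//.
transitivity (\sum_(i < m | (i < j)%N) 1)%N.
  rewrite [RHS]big_mkcond; apply: eq_bigr => i _.
  case: ltnP => [ij|ji].
    by rewrite (le_lt_trans _ tju)//; exact: t_nd.
  by rewrite ltNge (le_trans utj)//; exact: t_nd.
rewrite sum1_card.
transitivity #|'I_j|; last by rewrite card_ord.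
have jm : (j <= m)%N by rewrite -ltnS.
rewrite -[RHS](card_codom (f := fun i : 'I_j => widen_ord jm i)); last first.
  by move=> a b /(congr1 val)/= /val_inj.
apply: eq_card => i; rewrite unfold_in; apply/idP/codomP => [ij|[a ->]].
  by exists (Ordinal ij); exact/val_inj.
exact: (ltn_ord a).
Qed.

Lemma cell_in u : t 0%N < u <= t m.+1 -> t (cell u) < u <= t (cell u).+1.
Proof.
move=> /andP[t0u utm].
have ex : exists i, u <= t i.+1 by exists m.
pose j := ex_minn ex.
have [uj jmin] : u <= t j.+1 /\ forall i, u <= t i.+1 -> (j <= i)%N.
  by rewrite /j; case: ex_minnP.
have tj : t j < u.
  case: (j) jmin => [//|i] imin.
  by rewrite ltNge; apply/negP => /imin; rewrite ltnn.
have jm : (j < m.+1)%N by rewrite ltnS jmin.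
have := @cell_eq u (Ordinal jm); rewrite /= tj uj => -> //=.
by rewrite tj uj.
Qed.

Lemma cellP u (j : 'I_m.+1) : t 0%N < u <= t m.+1 ->
  (cell u == j) = (t j < u <= t j.+1).
Proof.
by move=> tu; apply/eqP/idP => [<-|/cell_eq//]; exact: cell_in.
Qed.

End cells.

(** * Order statistics of a uniform sample *)

Section measure_fibers.
Context d (T : measurableType d) (R : realType).
Variable mu : {measure set T -> \bar R}.

Lemma measurable_seq_fibers (I : eqType) (A : set T) (X : T -> I) (s : seq I) :
  (forall x, measurable (A `&` [set w | X w = x])) ->
  measurable (A `&` [set w | X w \in s]).
Proof.
move=> mX; elim: s => [|x s IHs].
  by rewrite [X in measurable X](_ : _ = set0)// -subset0 => w [].
rewrite [X in measurable X](_ : _ =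
  (A `&` [set w | X w = x]) `|` (A `&` [set w | X w \in s])).
  exact: measurableU.
apply/seteqP; split => w /=; rewrite inE.
  by move=> [Aw /predU1P[|]]; [left|right].
by move=> [[Aw /eqP Xx]|[Aw Xs]]; split=> //; rewrite ?Xx ?Xs ?orbT.
Qed.

Lemma measure_seq_fibers (I : eqType) (A : set T) (X : T -> I) (s : seq I) :
  (forall x, measurable (A `&` [set w | X w = x])) -> uniq s ->
  mu (A `&` [set w | X w \in s]) =
  (\sum_(x <- s) mu (A `&` [set w | X w = x]))%E.
Proof.
move=> mX; elim: s => [_|x s IHs /= /andP[xs us]].
  rewrite big_nil -[RHS](measure0 mu); congr (mu _).
  by rewrite -subset0 => w [].
rewrite big_cons -IHs// -measureU//.
- congr (mu _); apply/seteqP; split => w /=; rewrite inE.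
    by move=> [Aw /predU1P[|]]; [left|right].
  by move=> [[Aw /eqP Xx]|[Aw Xs]]; split=> //; rewrite ?Xx ?Xs ?orbT.
- exact: measurable_seq_fibers.
- rewrite -subset0 => w [[_ /= Xx] [_ /=]]; rewrite Xx.
  by move/negbTE: xs => ->.
Qed.

End measure_fibers.

Section uniform_sample.
Context d (Omega : measurableType d) (R : realType) (Q : probability Omega R).
Variables (k : nat) (V : 'I_k -> {RV Q >-> R}) (L : R) (L0 : 0 < L).
Hypothesis hVunif : forall (i : 'I_k) (A : set R), measurable A ->
  distribution Q (V i) A = uniform_prob L0 A.
Hypothesis hVindep : mutually_independent Q (fun i => V i : Omega -> R).

Let U := order_statistics (fun i => V i : Omega -> R).

Lemma uniform_itv i a b : 0 <= a -> a <= b -> b <= L ->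
  Q (V i @^-1` `]a, b]) = ((b - a) / L)%:E.
Proof.
move=> a0 ab bL; have := @hVunif i `]a, b]%classic (measurable_itv _).
rewrite /distribution/= /pushforward => ->; rewrite /uniform_prob.
under eq_integral => x.
  rewrite inE/= in_itv/= => /andP[ax xb].
  rewrite /uniform_pdf subr0 ifT; last first.
    by rewrite (le_trans a0 (ltW ax)) (le_trans xb).
  over.
rewrite integral_cst//= lebesgue_measure_itv/= lte_fin.
case: ltP => [_|ba]; first by rewrite -EFinD -EFinM mulrC.
by rewrite mule0 (@le_anti _ _ a b) ?ab// subrr mul0r.
Qed.

(** The left end is excluded because the cells are open on the left; their union is exactly ]0,
    L]. *)
Definition in_range := \bigcap_i (V i @^-1` `]0, L]).

Lemma in_rangeP w : in_range w <-> forall i, 0 < V i w <= L.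
Proof.
by split=> [h i|h i _]; [have /= := h i I|]; rewrite /= in_itv/=.
Qed.

Lemma measurable_bigcap_preimage (A : 'I_k -> set R) :
  (forall i, measurable (A i)) -> measurable (\bigcap_i (V i @^-1` A i)).
Proof.
move=> mA; apply: fin_bigcap_measurable => //= i _.
exact: measurable_funPTI.
Qed.

Lemma measurable_in_range : measurable in_range.
Proof. by apply: measurable_bigcap_preimage => i. Qed.

Lemma in_range1 : Q in_range = 1%E.
Proof.
rewrite /in_range hVindep => [|i]; last exact: measurable_itv.
rewrite big1// => i _; rewrite uniform_itv ?lexx ?ltW//.
by rewrite subr0 divff ?gt_eqF.
Qed.

Lemma out_range0 : Q (~` in_range) = 0%E.
Proof.
by rewrite probability_setC ?in_range1 ?subee//; exact: measurable_in_range.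
Qed.

Variable m : nat.
Let t (j : nat) := j%:R * L / m.+1%:R.

Lemma grid_nd : {homo t : i j / (i <= j)%N >-> i <= j}.
Proof. by move=> i j ij; rewrite ler_pM2r ?invr_gt0// ler_pM2r// ler_nat. Qed.

Lemma grid_itv u : (t 0 < u <= t m.+1) = (0 < u <= L).
Proof. by rewrite /t !mul0r mulrAC divff ?mul1r. Qed.

(** Before sorting, prescribing the cells is a box event, to which independence applies directly. *)
Lemma sample_cellE (s : seq 'I_m.+1) (ss : size s = k) :
  in_range `&` [set w | [seq cell t m (V i w) | i <- enum 'I_k] = s] =
  \bigcap_i (V i @^-1` `]t (nth ord0 s i), t (nth ord0 s i).+1]).
Proof.
apply/seteqP; split=> [w [/in_rangeP Lw /= ws] i _ /=|w ws].
  rewrite in_itv/= -cellP ?grid_itv//; last exact: grid_nd.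
  rewrite -ws (nth_map i) ?size_enum_ord// nth_ord_enum//.
have Lw i : 0 < V i w <= L.
  have := ws i I; rewrite /= in_itv/= => /andP[tV Vt].
  rewrite -grid_itv (le_lt_trans _ tV) ?(le_trans Vt)//; apply: grid_nd => //.
split; first exact/in_rangeP.
apply: (@eq_from_nth _ ord0) => [|i]; rewrite size_map size_enum_ord => // ik.
rewrite (nth_map (Ordinal ik)) ?size_enum_ord//.
have -> : nth (Ordinal ik) (enum 'I_k) i = Ordinal ik.
  exact: (nth_ord_enum (Ordinal ik) (Ordinal ik)).
apply: cell_eq; first exact: grid_nd.
by have := ws (Ordinal ik) I; rewrite /= in_itv.
Qed.

Lemma measurable_sample_cell (s : seq 'I_m.+1) :
  measurable (in_range `&`
    [set w | [seq cell t m (V i w) | i <- enum 'I_k] = s]).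
Proof.
have [ss|ss] := eqVneq (size s) k.
  by rewrite sample_cellE//; apply: measurable_bigcap_preimage.
rewrite [X in measurable X](_ : _ = set0)// -subset0 => w [_ /= ws].
by move: ss; rewrite -ws size_map size_enum_ord eqxx.
Qed.

Lemma measure_sample_cell (s : seq 'I_m.+1) : size s = k ->
  Q (in_range `&` [set w | [seq cell t m (V i w) | i <- enum 'I_k] = s]) =
  (m.+1%:R^-1 ^+ k)%:E.
Proof.
move=> ss; rewrite sample_cellE//.
rewrite (hVindep (fun i => measurable_itv _)).
transitivity (\prod_(i < k) (m.+1%:R^-1 : R)%:E)%E.
  apply: eq_bigr => i _; rewrite uniform_itv.
  - congr EFin; rewrite /t -natr1; field; rewrite !gt_eqF//= ?ltr_wpDl.
  - by rewrite /t divr_ge0// mulr_ge0// ltW.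
  - exact: grid_nd.
  - by rewrite -[leRHS](_ : t m.+1 = _) ?grid_nd// /t mulrAC divff ?mul1r.
by rewrite prodEFin prodr_const card_ord.
Qed.

(** [cell] is monotone, so it commutes with sorting: the cells of the order statistics are the
    sorted cells of the sample. The event thus splits into the labelled arrangements of [tau], all
    equally likely. *)
Lemma order_statistics_cellE (w : Omega) (tau : seq 'I_m.+1) :
  sorted <=%O tau ->
  ([seq cell t m u | u <- U w] == tau) =
  ([seq cell t m (V i w) | i <- enum 'I_k] \in permutations tau).
Proof.
move=> stau; rewrite mem_permutations.
have pU : perm_eq [seq cell t m u | u <- U w]
    [seq cell t m (V i w) | i <- enum 'I_k].
  rewrite (map_comp (cell t m) (fun i => V i w)); apply/perm_map.
  by rewrite perm_sort.
have sU : sorted <=%O [seq cell t m u | u <- U w].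
  have /= := sort_sorted (@le_total _ R) [seq V i w | i <- enum 'I_k].
  by apply: homo_sorted; exact: cell_homo.
apply/eqP/idP => [<-|ptau]; first by rewrite perm_sym.
by apply: (sorted_eq le_trans le_anti) => //; exact: perm_trans pU ptau.
Qed.

Lemma measurable_order_statistics_cell (tau : seq 'I_m.+1) :
  measurable (in_range `&` [set w | [seq cell t m u | u <- U w] = tau]).
Proof.
have [stau|stau] := boolP (sorted <=%O tau).
  rewrite [X in measurable X](_ : _ = in_range `&`
    [set w | [seq cell t m (V i w) | i <- enum 'I_k] \in permutations tau]).
    by apply: measurable_seq_fibers => x; exact: measurable_sample_cell.
  congr (_ `&` _); apply/seteqP; split => w /=.
    by rewrite -order_statistics_cellE// => /eqP.
  by rewrite -order_statistics_cellE// => /eqP.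
rewrite [X in measurable X](_ : _ = set0)// -subset0 => w [_ /= ws].
move: stau; rewrite -ws => /negP; apply.
have /= := sort_sorted (@le_total _ R) [seq V i w | i <- enum 'I_k].
by apply: homo_sorted; exact: cell_homo.
Qed.

Lemma measure_order_statistics_cell (tau : seq 'I_m.+1) :
  sorted <=%O tau -> size tau = k ->
  Q (in_range `&` [set w | [seq cell t m u | u <- U w] = tau]) =
  ((size (permutations tau))%:R * m.+1%:R^-1 ^+ k)%:E.
Proof.
move=> stau ktau.
rewrite [X in Q (_ `&` X)](_ : _ =
    [set w | [seq cell t m (V i w) | i <- enum 'I_k] \in permutations tau]).
  rewrite measure_seq_fibers ?permutations_uniq//; last first.
    by move=> x; exact: measurable_sample_cell.
  rewrite (eq_big_seq (fun=> (m.+1%:R^-1 ^+ k)%:E)) => [|s].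
    by rewrite sumEFin big_const_seq count_predT iter_addr_0 mulr_natl.
  rewrite mem_permutations => /perm_size; rewrite ktau => ss.
  exact: measure_sample_cell.
apply/seteqP; split => w /=.
  by rewrite -order_statistics_cellE// => /eqP.
by rewrite -order_statistics_cellE// => /eqP.
Qed.

End uniform_sample.

(** * Measurability of sorted lists and limits of distribution functions *)

(** Counts below a level are the events assumed measurable for a spike train; this equivalence
    carries measurability over to the points themselves. *)
Lemma sorted_nth_le (R : realType) (s : seq R) (j : nat) (y : R) :
  sorted <=%R s -> (j < size s)%N ->
  (s`_j <= y) = (j < count (fun u => (u <= y)%R) s)%N.
Proof.
move=> ss js; apply/idP/idP => [sy|].
  rewrite -[s in count _ s](cat_take_drop j.+1) count_cat ltn_addr//.
  have : all (fun u => u <= y) (take j.+1 s).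
    apply/(all_nthP 0) => i; rewrite size_take_min => ij.
    rewrite nth_take; last by lia.
    apply: le_trans sy.
    apply: (sorted_leq_nth le_trans le_refl) => //; rewrite ?inE;
      by move: ij; rewrite leq_min ltnS => /andP[].
  by rewrite all_count => /eqP ->; rewrite size_take_min leq_min ltnSn.
apply: contraTT; rewrite -ltNge -leqNgt => ys.
rewrite -[s in count _ s](cat_take_drop j) count_cat.
have -> : count (fun u => u <= y) (drop j s) = 0%N.
  apply/eqP; rewrite -leqn0 leqNgt -has_count -all_predC.
  apply/(all_nthP 0) => i; rewrite size_drop => ij /=.
  rewrite nth_drop -ltNge; apply: lt_le_trans ys _.
  by apply: (sorted_leq_nth le_trans le_refl) => //;
    rewrite ?inE -?ltn_subRL ?leq_addr.
by rewrite addn0 (leq_trans (count_size _ _))// size_take_min geq_minl.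
Qed.

Section random_list.
Context d (T : measurableType d) (R : realType) (X : T -> seq R).
Hypothesis Xs : forall w, sorted <=%R (X w).
Hypothesis Xm : forall y n,
  measurable [set w | count (fun u => (u <= y)%R) (X w) = n].

Lemma measurable_nth_sorted (D : set T) (k j : nat) : measurable D ->
  (forall w, D w -> size (X w) = k) -> (j < k)%N ->
  measurable_fun D (fun w => (X w)`_j).
Proof.
move=> mD Dk jk; apply: (measurability _ (RGenOInfty.measurableE R)) => //.
move=> _ [_ [y ->] <-].
rewrite [X in measurable X](_ : _ = D `\`
  \bigcup_(n in [set n | (j < n)%N])
    [set w | count (fun u => (u <= y)%R) (X w) = n]).
  by apply: measurableD => //; apply: bigcup_measurable => n _.
apply/seteqP; split => w /=.
  move=> [Dw]; rewrite in_itv/= andbT ltNge => yX; split=> // -[n /= jn wn].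
  by move: yX; rewrite (sorted_nth_le y (Xs w)) ?Dk// wn jn.
move=> [Dw wn]; split=> //; rewrite in_itv/= andbT ltNge.
rewrite (sorted_nth_le y (Xs w)) ?Dk//; apply/negP => jn; apply: wn.
by eexists; last reflexivity.
Qed.

(** Stated with a map [phi] to serve both sides: the identity for the uniform sample, the cumulative
    intensity for the process. *)
Lemma measurable_spacings_prod (D : set T) (k : nat) (phi : R -> R) (L : R) :
  measurable D -> (forall w, D w -> size (X w) = k) ->
  measurable_fun setT phi ->
  measurable_fun D (fun w => spacings_prod (0 :: rcons (map phi (X w)) L)).
Proof.
move=> mD Dk mphi.
have mY i : (i <= k.+1)%N ->
    measurable_fun D (fun w => (0 :: rcons (map phi (X w)) L)`_i).
  case: i => [_ /=|i]; first exact: measurable_cst.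
  rewrite ltnS leq_eqVlt => /predU1P[->|ik].
    apply: (eq_measurable_fun (cst L)); last exact: measurable_cst.
    by move=> w; rewrite inE => /Dk wk; rewrite /= nth_rcons size_map wk ltnn eqxx.
  apply: (eq_measurable_fun (phi \o (fun w => (X w)`_i))).
    move=> w; rewrite inE => /Dk wk.
    by rewrite /= nth_rcons size_map wk ik (nth_map 0)// wk.
  apply: measurableT_comp => //; exact: (measurable_nth_sorted _ Dk).
apply: (eq_measurable_fun (fun w => \prod_(i < k.+1)
  ((0 :: rcons (map phi (X w)) L)`_i.+1 - (0 :: rcons (map phi (X w)) L)`_i))).
  by move=> w; rewrite inE => /Dk wk; rewrite spacings_prodE size_map wk.
apply: measurable_prod => i _; apply: measurable_funB; apply: mY => //.
exact: ltnW.
Qed.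

End random_list.

Section finite_sample.
Context d (T : measurableType d) (R : realType).

Lemma measurable_count_le (I : Type) (V : I -> T -> R) (r : seq I) (y : R) n :
  (forall i, measurable_fun setT (V i)) ->
  measurable [set w | count (fun u => (u <= y)%R) [seq V i w | i <- r] = n].
Proof.
move=> mV; elim: r n => [|i r IHr] n /=.
  by case: n => [|n]; [rewrite [X in measurable X](_ : _ = setT)//|
    rewrite [X in measurable X](_ : _ = set0)//]; apply/seteqP; split.
have mi : measurable [set w | V i w <= y].
  rewrite -[X in measurable X]setTI.
  have := mV i measurableT _ (measurable_itv `]-oo, y]).
  by congr (measurable (_ `&` _)); apply/seteqP; split => w /=; rewrite in_itv.
rewrite [X in measurable X](_ : _ = ([set w | V i w <= y] `&`
    \bigcup_(p in [set p | p.+1 = n])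
      [set w | count (fun u => (u <= y)%R) [seq V i w | i <- r] = p]) `|`
    (~` [set w | V i w <= y] `&`
      [set w | count (fun u => (u <= y)%R) [seq V i w | i <- r] = n])).
  apply: measurableU; apply: measurableI => //; last exact: measurableC.
  by apply: bigcup_measurable.
apply/seteqP; split => w /=.
  case: leP => _; rewrite ?add1n ?add0n => wn; last by right.
  by left; split => //; eexists; [exact: wn|].
by case=> [[-> [p /= <- ->]]|[/negP/negbTE -> ->]].
Qed.

Lemma measurable_order_statistics_spacings k (V : 'I_k -> T -> R) (L : R) :
  (forall i, measurable_fun setT (V i)) ->
  measurable_fun setT
    (fun w => spacings_prod (0 :: rcons (order_statistics V w) L)).
Proof.
move=> mV.
rewrite (_ : (fun w => _) = fun w => spacings_prod
    (0 :: rcons (map id (order_statistics V w)) L)); last first.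
  by apply/funext => w; rewrite map_id.
apply: (@measurable_spacings_prod _ T R (order_statistics V) _ _ setT k) => //.
- by move=> w; exact: (sort_sorted le_total).
- move=> y n; have := measurable_count_le (enum 'I_k) y n mV.
  congr measurable; apply/seteqP; split => w /=;
    by rewrite (permP (permEl (perm_sort _ _))).
- by move=> w _; rewrite size_sort size_map size_enum_ord.
Qed.

End finite_sample.

Lemma exists_natSinv_lt (R : realType) (e : R) : 0 < e ->
  exists n, n.+1%:R^-1 < e.
Proof.
move=> e0; have [n _ /(_ n (leqnn n))] := near_infty_natSinv_lt (PosNum e0).
by exists n.
Qed.

Section cdf_limits.
Context d (T : measurableType d) (R : realType).
Variable mu : {finite_measure set T -> \bar R}.
Variables (D : set T) (G : T -> R).
Hypotheses (mD : measurable D) (mG : measurable_fun D G).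

Lemma measurable_fun_leS c : measurable (D `&` [set w | G w <= c]).
Proof.
have := mG mD (measurable_itv `]-oo, c]).
by congr (measurable (_ `&` _)); apply/seteqP; split => w /=; rewrite in_itv.
Qed.

Lemma measurable_fun_ltS c : measurable (D `&` [set w | G w < c]).
Proof.
have := mG mD (measurable_itv `]-oo, c[).
by congr (measurable (_ `&` _)); apply/seteqP; split => w /=; rewrite in_itv.
Qed.

Lemma cvg_measure_lt c :
  (fun n => mu (D `&` [set w | G w <= c - n.+1%:R^-1])) @ \oo -->
  mu (D `&` [set w | G w < c]).
Proof.
have -> : D `&` [set w | G w < c] =
    \bigcup_n (D `&` [set w | G w <= c - n.+1%:R^-1]).
  apply/seteqP; split => w /=.
    move=> [Dw Gc].
    have [n nc] : exists n, n.+1%:R^-1 < c - G w.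
      by apply: exists_natSinv_lt; rewrite subr_gt0.
    by exists n => //; split => //=; rewrite lerBrDr addrC -lerBrDr ltW.
  move=> [n _ [Dw /= Gn]]; split=> //; apply: le_lt_trans Gn _.
  by rewrite ltrBlDr ltrDl invr_gt0.
apply: nondecreasing_cvg_mu.
- by move=> n; exact: measurable_fun_leS.
- by apply: bigcup_measurable => n _; exact: measurable_fun_leS.
- move=> n p np; apply/subsetPset => w [Dw /= Gn]; split=> //=.
  by rewrite (le_trans Gn)// lerD2l lerN2 lef_pV2 ?posrE// ler_nat.
Qed.

Lemma cvg_measure_le c :
  (fun n => mu (D `&` [set w | G w <= c + n.+1%:R^-1])) @ \oo -->
  mu (D `&` [set w | G w <= c]).
Proof.
have -> : D `&` [set w | G w <= c] =
    \bigcap_n (D `&` [set w | G w <= c + n.+1%:R^-1]).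
  apply/seteqP; split => w /=.
    by move=> [Dw Gc] n _; split => //=; rewrite (le_trans Gc)// lerDl.
  move=> h; split; first by have [] := h 0%N I.
  rewrite leNgt; apply/negP => Gc.
  have [n nc] : exists n, n.+1%:R^-1 < G w - c.
    by apply: exists_natSinv_lt; rewrite subr_gt0.
  by have [_ /=] := h n I; rewrite leNgt -ltrBrDl nc.
apply: nonincreasing_cvg_mu => //=.
- by rewrite ltey_eq fin_num_measure//; exact: measurable_fun_leS.
- by move=> n; exact: measurable_fun_leS.
- by apply: bigcap_measurable => // n _; exact: measurable_fun_leS.
- move=> n p np; apply/subsetPset => w [Dw /= Gn]; split=> //=.
  by rewrite (le_trans Gn)// lerD2l lef_pV2 ?posrE// ler_nat.
Qed.

Lemma measure_le_lim (x : \bar R) c :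
  (forall e, 0 < e -> (x <= mu (D `&` [set w | (G w <= c + e)%R]))%E) ->
  (x <= mu (D `&` [set w | (G w <= c)%R]))%E.
Proof.
move=> h; have cv := @cvg_measure_le c; rewrite -(cvg_lim _ cv)//.
by apply: lime_ge; [exact: cvgP cv|apply: nearW => n; exact: h].
Qed.

End cdf_limits.

Section close_laws.
Context d1 (T1 : measurableType d1) d2 (T2 : measurableType d2) (R : realType).
Variables (mu1 : {finite_measure set T1 -> \bar R})
  (mu2 : {finite_measure set T2 -> \bar R}) (a : R).
Variables (D1 : set T1) (D2 : set T2) (G1 : T1 -> R) (G2 : T2 -> R).
Hypotheses (a0 : 0 < a) (mD1 : measurable D1) (mD2 : measurable D2)
  (mG1 : measurable_fun D1 G1) (mG2 : measurable_fun D2 G2).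
Hypothesis approx : forall e, 0 < e -> exists (H1 : T1 -> R) (H2 : T2 -> R),
  [/\ forall w, D1 w -> `|G1 w - H1 w| <= e,
      forall w, D2 w -> `|G2 w - H2 w| <= e &
      forall c,
        [/\ measurable (D1 `&` [set w | H1 w <= c]),
            measurable (D2 `&` [set w | H2 w <= c]) &
            mu1 (D1 `&` [set w | H1 w <= c]) =
            (a%:E * mu2 (D2 `&` [set w | (H2 w <= c)%R]))%E]].

(** The event G1 <= c lies in H1 <= c + e/2, whose mass is [a] times that of H2 <= c + e/2, which
    lies in G2 <= c + e. Continuity from above removes [e], and the argument is symmetric. In the
    application [a] is P(|S| = k). *)
Lemma eq_measure_le c : mu1 (D1 `&` [set w | G1 w <= c]) =
  (a%:E * mu2 (D2 `&` [set w | (G2 w <= c)%R]))%E.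
Proof.
apply/le_anti/andP; split.
  rewrite -lee_pdivrMl//; apply: (measure_le_lim mD2 mG2) => e e0.
  have [H1 [H2 [GH1 GH2 HH]]] := approx (divr_gt0 e0 (ltr0n R 2)).
  have [mH1 mH2 eqH] := HH (c + e / 2).
  rewrite lee_pdivrMl//.
  apply: (@le_trans _ _ (mu1 (D1 `&` [set w | H1 w <= c + e / 2]))).
    apply: le_measure; rewrite ?inE//; first exact: measurable_fun_leS.
    move=> w [Dw /= Gc]; split=> //=.
    by have := GH1 w Dw; rewrite ler_norml; lra.
  rewrite eqH lee_pmul2l// ?lte_fin//.
  apply: le_measure; rewrite ?inE//; first exact: measurable_fun_leS.
  move=> w [Dw /= Gc]; split=> //=.
  by have := GH2 w Dw; rewrite ler_norml; lra.
apply: (measure_le_lim mD1 mG1) => e e0.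
have [H1 [H2 [GH1 GH2 HH]]] := approx (divr_gt0 e0 (ltr0n R 2)).
have [mH1 mH2 eqH] := HH (c + e / 2).
apply: (@le_trans _ _ (mu1 (D1 `&` [set w | H1 w <= c + e / 2]))).
  rewrite eqH lee_pmul2l// ?lte_fin//.
  apply: le_measure; rewrite ?inE//; first exact: measurable_fun_leS.
  move=> w [Dw /= Gc]; split=> //=.
  by have := GH2 w Dw; rewrite ler_norml; lra.
apply: le_measure; rewrite ?inE//; first exact: measurable_fun_leS.
move=> w [Dw /= Gc]; split=> //=.
by have := GH1 w Dw; rewrite ler_norml; lra.
Qed.

Lemma eq_measure_lt c : mu1 (D1 `&` [set w | G1 w < c]) =
  (a%:E * mu2 (D2 `&` [set w | (G2 w < c)%R]))%E.
Proof.
have h1 := @cvg_measure_lt _ _ _ mu1 _ _ mD1 mG1 c.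
have h2 := @cvg_measure_lt _ _ _ mu2 _ _ mD2 mG2 c.
rewrite -(cvg_lim _ h1)//; apply/cvg_lim => //.
under eq_fun do rewrite eq_measure_le.
by apply: cvgeZl.
Qed.

End close_laws.

(** * Absence of atoms *)

Lemma sorted_cons_rcons (R : realType) (s : seq R) (L : R) : 0 <= L ->
  sorted <=%R s -> all (fun u => 0 <= u <= L) s -> sorted <=%R (0 :: rcons s L).
Proof.
move=> L0 ss sL /=; rewrite (path_min_sorted (s := rcons s L)); last first.
  by rewrite all_rcons L0/=; apply: sub_all sL => u /andP[].
case: s ss sL => [//|x s] /= ss sL.
rewrite rcons_path ss/=.
by have /andP[] := @allP _ _ (x :: s) sL _ (mem_last x s).
Qed.

Section independence.
Context d (Omega : measurableType d) (R : realType) (Q : probability Omega R).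
Variables (k : nat) (V : 'I_k -> {RV Q >-> R}).
Hypothesis hVindep : mutually_independent Q (fun i => V i : Omega -> R).
Variable i0 : 'I_k.

(* The pi-system generating the sigma-algebra of the [V i] with [i != i0]. *)
Definition others_system : set (set Omega) :=
  [set B | exists A : 'I_k -> set R, (forall i, measurable (A i)) /\
    B = \bigcap_(i in [set i | i != i0]) (V i @^-1` A i)].

(** The sample space with this smaller sigma-algebra: measurability of a function on it expresses
    that the function depends only on the points other than [V i0]. *)
Definition others := g_sigma_algebraType others_system.

Lemma measurable_others_system : others_system `<=` measurable.
Proof.
move=> _ [A [mA ->]]; apply: fin_bigcap_measurable => //= i _.
exact: measurable_funPTI.
Qed.

Lemma measurable_others (B : set Omega) : <<s others_system >> B -> measurable B.
Proof.
exact: (smallest_sub (@sigma_algebra_measurable _ Omega) measurable_others_system).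
Qed.

Lemma others_systemI : setI_closed others_system.
Proof.
move=> _ _ [A [mA ->]] [B [mB ->]].
exists (fun i => A i `&` B i); split; first by move=> i; exact: measurableI.
apply/seteqP; split => w.
  by move=> [wA wB] i /= ii0; split; [exact: wA|exact: wB].
by move=> wAB; split => i /= ii0; have [] := wAB i ii0.
Qed.

Lemma others_systemT : others_system setT.
Proof. by exists (fun=> setT); split => //; apply/seteqP; split. Qed.

(** With [A] fixed, both sides are finite measures in [B]; they agree on a pi-system, hence on the
    sigma-algebra that it generates. *)
Lemma others_independent (A : set R) (B : set Omega) : measurable A ->
  <<s others_system >> B ->
  Q (V i0 @^-1` A `&` B) = (Q (V i0 @^-1` A) * Q B)%E.
Proof.
move=> mA sB; have mVA : measurable (V i0 @^-1` A) by exact: measurable_funPTI.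
have p0 : 0 <= fine (Q (V i0 @^-1` A)) by exact: fine_ge0.
pose m1 := mrestr Q mVA; pose m2 := mscale (NngNum p0) Q.
have m2E X : m2 X = (Q (V i0 @^-1` A) * Q X)%E.
  by rewrite /m2 /mscale/= fineK// fin_num_measure.
rewrite -m2E setIC -[LHS]/(m1 B).
apply: (@g_sigma_algebra_measure_unique _ _ _ others_system
  measurable_others_system (fun=> setT) (fun=> others_systemT) _ m1 m2
  others_systemI _ _ _ sB).
- by rewrite bigcup_const//; exists 0%N.
- move=> _ [C [mC ->]]; rewrite -[RHS]/(m2 _) m2E -[LHS]/(m1 _) /m1 /mrestr.
  (* The set of index [i0] is left free: X = A gives the joint event, X = setT the event of the
     other points alone. *)
  pose C' (i : 'I_k) (X : set R) := if i == i0 then X else C i.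
  have mC' X : measurable X -> forall i, measurable (C' i X).
    by move=> mX i; rewrite /C'; case: ifP.
  have C'E X : \bigcap_i (V i @^-1` C' i X) =
      (\bigcap_(i in [set i | i != i0]) V i @^-1` C i) `&` V i0 @^-1` X.
    apply/seteqP; split=> [w h|w [h1 h2] i _].
      split; last by have := h i0 I; rewrite /C' eqxx.
      by move=> i /= /negbTE ii0; have := h i I; rewrite /C' ii0.
    by rewrite /C'; case: eqVneq => [->//|ii0]; exact: h1.
  rewrite -C'E hVindep; last exact: mC'.
  have -> : \bigcap_(i in [set i | i != i0]) V i @^-1` C i =
      \bigcap_i V i @^-1` C' i setT by rewrite C'E preimage_setT setIT.
  rewrite hVindep; last exact: mC'.
  rewrite [in LHS](bigD1 i0)//= [in RHS](bigD1 i0)//= /C' eqxx.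
  rewrite preimage_setT probability_setT mul1e; congr (_ * _)%E.
  by apply: eq_bigr => i /negbTE ->.
- move=> _; rewrite -[X in (X < _)%E]/(m1 setT) /m1 /mrestr setTI.
  by rewrite ltey_eq fin_num_measure.
Qed.

Lemma measurable_fun_others (i : 'I_k) : i != i0 ->
  measurable_fun (setT : set others) (V i).
Proof.
move=> ii0 _ A mA; rewrite setTI; apply: sub_sigma_algebra.
exists (fun j => if j == i then A else setT); split.
  by move=> j; case: ifP.
apply/seteqP; split=> [w wA j _|w h] /=; first by case: eqVneq => [->|].
by have := h i ii0; rewrite eqxx.
Qed.

End independence.

Section uniform_sample_atomless.
Context d (Omega : measurableType d) (R : realType) (Q : probability Omega R).
Variables (k : nat) (V : 'I_k -> {RV Q >-> R}) (L : R) (L0 : 0 < L).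
Hypothesis hVunif : forall (i : 'I_k) (A : set R), measurable A ->
  distribution Q (V i) A = uniform_prob L0 A.
Hypothesis hVindep : mutually_independent Q (fun i => V i : Omega -> R).

Let U := order_statistics (fun i => V i : Omega -> R).

(** The single source of null sets below. It is applied with [H] another sample point, the constant
    L, and a root of the quadratic equation in the largest point. *)
Lemma negligible_eq_others (i0 : 'I_k) (H : Omega -> R) :
  measurable_fun (setT : set (others V i0)) H ->
  Q.-negligible [set w | V i0 w = H w].
Proof.
move=> mH; have mH' : measurable_fun setT H.
  move=> _ B mB; rewrite setTI; apply: measurable_others.
  by rewrite -[X in <<s _ >> X]setTI; apply: mH.
have mI : measurable (in_range V L) by exact: measurable_in_range.
pose A := in_range V L `&` [set w | V i0 w = H w].
have mE : measurable [set w | V i0 w = H w].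
  have mtrue : measurable [set true] by [].
  have := measurable_fun_eqr (measurable_funPT (V i0)) mH' measurableT mtrue.
  by rewrite setTI; congr measurable; apply/seteqP; split => w /= /eqP.
have QI : Q (~` in_range V L) = 0%E.
  exact: (out_range0 hVunif hVindep).
suff QA : Q A = 0%E.
  have : [set w | V i0 w = H w] `<=` A `|` ~` in_range V L.
    move=> w /= VH; have [wI|wI] := pselect (in_range V L w); last by right.
    by left.
  move=> /negligibleS; apply.
  apply: negligibleU; apply/negligibleP => //; first exact: measurableI.
  exact: measurableC.
have mA : measurable A by exact: measurableI.
apply/le_anti/andP; split => //.
(* Divide [0, L] into [n.+1] cells: [V i0 = H] forces both into the same cell,
   which by independence has probability [1 / n.+1] given the cell of [H]. *)
suff QAn n : (Q A <= (n.+1%:R^-1)%:E)%E.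
  apply/lee_addgt0Pr => e e0; rewrite add0e.
  have [n ne] := exists_natSinv_lt e0.
  by rewrite (le_trans (QAn n))// lee_fin ltW.
pose t (j : nat) : R := j%:R * L / n.+1%:R.
pose J (j : 'I_n.+1) := `]t j, t j.+1]%classic.
have tnd : {homo t : i j / (i <= j)%N >-> i <= j} by exact: grid_nd.
have mJ j : measurable (J j) by exact: measurable_itv.
have cellJ (X : Omega -> R) j : [set w | 0 < X w <= L] `&`
    [set w | cell t n (X w) = j] = X @^-1` J j.
  apply/seteqP; split => w; rewrite /J /preimage/= in_itv/=.
    by move=> [Xw /eqP]; rewrite cellP// grid_itv.
  move=> Xj; split; last exact: cell_eq Xj.
  have := Xj => /andP[tX Xt].
  rewrite -(grid_itv L n) (le_lt_trans _ tX) ?(le_trans Xt)//; exact: tnd.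
have mcell (X : Omega -> R) : measurable_fun setT X -> forall j, measurable
    ([set w | 0 < X w <= L] `&` [set w | cell t n (X w) = j]).
  by move=> mX j; rewrite cellJ -[X in measurable X]setTI; apply: mX.
have AE : A = (A `&` [set w | cell t n (V i0 w) \in enum 'I_n.+1]).
  by apply/seteqP; split => w; [move=> Aw; split => //=; rewrite mem_enum|case].
have AJ j : A `&` [set w | cell t n (V i0 w) = j] = A `&` V i0 @^-1` J j.
  rewrite -(cellJ (V i0)) setIA; congr (_ `&` _).
  apply/seteqP; split => [w Aw|w []//]; split => //.
  by have [/in_rangeP wI _] := Aw; exact: wI.
rewrite AE measure_seq_fibers ?enum_uniq//; last first.
  by move=> j; rewrite AJ; apply: measurableI => //; exact: measurable_funPTI.
apply: (@le_trans _ _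
  (\sum_(j <- enum 'I_n.+1) ((n.+1%:R^-1)%:E * Q (H @^-1` J j)))%E).
  apply: lee_sum => j _; rewrite AJ.
  have sH : <<s others_system V i0 >> (H @^-1` J j).
    by rewrite -[X in <<s _ >> X]setTI; apply: mH.
  have QJ : Q (V i0 @^-1` J j) = (n.+1%:R^-1)%:E.
    rewrite (uniform_itv hVunif).
    - congr EFin; rewrite /t -natr1; field; rewrite !gt_eqF//= ?ltr_wpDl.
    - by rewrite /t divr_ge0// mulr_ge0// ltW.
    - exact: tnd.
    - by rewrite -[leRHS](_ : t n.+1 = _) ?tnd// /t mulrAC divff ?mul1r.
  rewrite -QJ -others_independent//.
  apply: le_measure; rewrite ?inE.
  - by apply: measurableI => //; exact: measurable_funPTI.
  - apply: measurableI; first exact: measurable_funPTI.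
    by rewrite -[X in measurable X]setTI; apply: mH'.
  - by move=> w [[_ /= VH] wJ]; split => //=; rewrite -VH.
rewrite -ge0_sume_distrr//.
rewrite -[leRHS]mule1 lee_pmul2l// ?lte_fin ?invr_gt0//.
under eq_bigr do rewrite -cellJ.
rewrite -measure_seq_fibers ?enum_uniq//; last exact: mcell.
apply: probability_le1; apply: measurable_seq_fibers; exact: mcell.
Qed.

End uniform_sample_atomless.

Section uniform_spacings.
Context d (Omega : measurableType d) (R : realType) (Q : probability Omega R).
Variables (k : nat) (V : 'I_k -> {RV Q >-> R}) (L : R) (L0 : 0 < L).
Hypothesis hVunif : forall (i : 'I_k) (A : set R), measurable A ->
  distribution Q (V i) A = uniform_prob L0 A.
Hypothesis hVindep : mutually_independent Q (fun i => V i : Omega -> R).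

Let U := order_statistics (fun i => V i : Omega -> R).
Let G w := spacings_prod (0 :: rcons (U w) L).

Lemma size_order_statistics w : size (U w) = k.
Proof. by rewrite size_sort size_map size_enum_ord. Qed.

Lemma order_statistics_in_range w : in_range V L w ->
  all (fun u => 0 <= u <= L) (U w).
Proof.
move=> /in_rangeP wI; rewrite all_sort all_map; apply/allP => i _ /=.
by have /andP[/ltW -> ->] := wI i.
Qed.

Lemma sorted_order_statistics w : in_range V L w ->
  sorted <=%R (0 :: rcons (U w) L).
Proof.
move=> wI; apply: sorted_cons_rcons; first exact: ltW.
  exact: (sort_sorted le_total).
exact: order_statistics_in_range.
Qed.

(** The sorting permutation depends on [w] but takes finitely many values, so null sets may be
    studied for one fixed order at a time. *)
Lemma order_statistics_map w : exists2 s : seq 'I_k,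
  s \in permutations (enum 'I_k) & U w = [seq V i w | i <- s].
Proof.
exists (sort (relpre (fun i => V i w) <=%R) (enum 'I_k)).
  by rewrite mem_permutations (permEl (perm_sort _ _)).
by rewrite /U /order_statistics sort_map.
Qed.

Lemma negligible_seq (I : eqType) (s : seq I) (F : I -> set Omega) :
  (forall i, i \in s -> Q.-negligible (F i)) ->
  Q.-negligible [set w | exists2 i, i \in s & F i w].
Proof.
elim: s => [|i s IHs] h.
  by apply: negligibleS (@negligible_set0 _ _ _ Q) => w [].
apply: (@negligibleS _ _ _ _ (F i `|`
    [set w | exists2 j, j \in s & F j w])).
  by move=> w [j]; rewrite inE => /predU1P[->|js Fj]; [left|right; exists j].
apply: negligibleU; first by apply: h; rewrite mem_head.
by apply: IHs => j js; apply: h; rewrite inE js orbT.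
Qed.

Lemma negligible_eq_sample i j : i != j -> Q.-negligible [set w | V i w = V j w].
Proof.
move=> ij; apply: (negligible_eq_others hVunif hVindep).
by apply: measurable_fun_others; rewrite eq_sym.
Qed.

Lemma negligible_out_range : Q.-negligible (~` in_range V L).
Proof.
have mI : measurable (in_range V L) by exact: measurable_in_range.
apply/negligibleP; first exact: measurableC.
exact: (out_range0 hVunif hVindep).
Qed.

(** A zero factor means a point at 0, a point at L, or two equal points. The first is excluded by
    [in_range]; the other two are [N2] and [N1]. *)
Lemma negligible_spacings0 : (0 < k)%N -> Q.-negligible [set w | G w = 0].
Proof.
move=> k0.
pose N1 := [set w | exists2 p : 'I_k * 'I_k, p \in enum [pred p | p.1 != p.2] &
  V p.1 w = V p.2 w].
pose N2 := [set w | exists2 i, i \in enum 'I_k & V i w = L].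
have nN1 : Q.-negligible N1.
  apply: (negligible_seq (F := fun p => [set w | V p.1 w = V p.2 w])) => p.
  by rewrite mem_enum => pp; exact: negligible_eq_sample.
have nN2 : Q.-negligible N2.
  apply: (negligible_seq (F := fun i => [set w | V i w = L])) => i _.
  apply: (negligible_eq_others (H := cst L) hVunif hVindep).
  exact: measurable_cst.
have nN := negligibleU negligible_out_range (negligibleU nN1 nN2).
apply: negligibleS nN => w /= Gw.
have [wI|wI] := pselect (in_range V L w); [right|by left].
move: Gw; rewrite /G spacings_prodE size_order_statistics.
have [s sp Us] := order_statistics_map w; rewrite Us.
have us : uniq s.
  by move: sp; rewrite mem_permutations => /perm_uniq ->; exact: enum_uniq.
have ss : size s = k.
  by move: sp; rewrite mem_permutations => /perm_size ->; rewrite size_enum_ord.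
have V0 i : V i w != 0.
  by move: wI => /in_rangeP /(_ i) /andP[/gt_eqF ->].
move/eqP; rewrite prodf_seq_eq0 => /hasP[[[|i] ik] _] /=; rewrite ltnS in ik.
- case: s ss us {sp Us} => [/= /esym k00|i s _ _] /=; first by rewrite k00 in k0.
  by rewrite subr0 (negbTE (V0 i)).
- rewrite subr_eq0 !nth_rcons size_map ss ik.
  have nthV j : (j < k)%N -> [seq V i w | i <- s]`_j = V (nth (Ordinal k0) s j) w.
    by move=> jk; rewrite (nth_map (Ordinal k0)) ?ss.
  move: (ik); rewrite leq_eqVlt => /predU1P[ik'|ik'].
    rewrite ik' ltnn eqxx nthV ?ik'// => /eqP VL; right.
    by exists (nth (Ordinal k0) s i) => //; rewrite mem_enum.
  rewrite ik' !nthV// => /eqP VV; left.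
  exists (nth (Ordinal k0) s i.+1, nth (Ordinal k0) s i) => //=.
  by rewrite mem_enum inE/= nth_uniq ?ss// gtn_eqF.
Qed.

Lemma measurable_others_nth (s : seq 'I_k) (i0 : 'I_k) j : i0 \notin s ->
  measurable_fun (setT : set (others V i0))
    (fun w => (0 :: [seq V i w | i <- s])`_j).
Proof.
move=> i0s; case: j => [|j] /=; first exact: measurable_cst.
have [js|sj] := ltnP j (size s); last first.
  under eq_fun do rewrite nth_default ?size_map//.
  exact: measurable_cst.
under eq_fun do rewrite (nth_map i0)//.
apply: measurable_fun_others; apply: contra i0s => /eqP <-.
exact: mem_nth.
Qed.

Lemma negligible_spacings_pos c : (0 < k)%N -> 0 < c ->
  Q.-negligible [set w | G w = c].
Proof.
move=> k0 c0.
(* If [X] is the largest point, [a] the previous one and [K] the product of the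
   spacings below [a], then [G = K (X - a) (L - X)], so that [G = c] makes [X]
   one of the two roots [H b], which depend on the other points only. *)
pose K (s : seq 'I_k) w := spacings_prod (0 :: [seq V i w | i <- s]).
pose a (s : seq 'I_k) w := last 0 [seq V i w | i <- s].
pose H (b : bool) s w := (a s w + L + (-1) ^+ b *
  (((L - a s w) ^+ 2 - 4 * c * K s w `^ (-1)) `^ 2^-1)) * 2^-1.
have mH b (s : seq 'I_k) i0 : i0 \notin s ->
    measurable_fun (setT : set (others V i0)) (H b s).
  move=> i0s.
  have ma : measurable_fun (setT : set (others V i0)) (a s).
    rewrite /a; under eq_fun do rewrite (last_nth 0) size_map.
    exact: measurable_others_nth.
  have mK : measurable_fun (setT : set (others V i0)) (K s).
    rewrite /K /spacings_prod; under eq_fun do rewrite /= size_map.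
    apply: measurable_prod => j _.
    apply: measurable_funB; first exact: (measurable_others_nth j.+1).
    exact: measurable_others_nth.
  (* The inverse and the square root in [H] are written as real powers, which are measurable on the
     whole line. Their conventional values are harmless: on the event studied, K > 0 and the
     discriminant is a square. *)
  have mpow p (g : Omega -> R) : measurable_fun (setT : set (others V i0)) g ->
      measurable_fun (setT : set (others V i0)) (fun w => g w `^ p).
    by move=> mg; exact: (measurableT_comp (measurable_powR p) mg).
  rewrite /H; apply: measurable_funM; last exact: measurable_cst.
  apply: measurable_funD.
    by apply: measurable_funD => //; exact: measurable_cst.
  apply: measurable_funM; first exact: measurable_cst.
  apply: (mpow 2^-1).
  apply: measurable_funB.
    apply: measurable_funX; apply: measurable_funB => //; exact: measurable_cst.
  apply: measurable_funM; first exact: measurable_cst.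
  exact: (mpow (-1) (K s)).

(* For a fixed increasing order [s], the last index carries the largest point, and [take k.-1 s]
   lists the others. *)
pose F (s : seq 'I_k) := [set w | s != [::] /\ exists b,
  V (last (Ordinal k0) s) w = H b (take k.-1 s) w].
have nF s : s \in permutations (enum 'I_k) -> Q.-negligible (F s).
  rewrite mem_permutations => sp.
  have ss : size s = k by rewrite (perm_size sp) size_enum_ord.
  have us : uniq s by rewrite (perm_uniq sp) enum_uniq.
  case/lastP: s ss us {sp} => [|s i0] ss us.
    by apply: negligibleS (@negligible_set0 _ _ _ Q) => w [].
  have sk : size s = k.-1 by move: (congr1 predn ss); rewrite size_rcons.
  have i0s : i0 \notin s by move: us; rewrite rcons_uniq => /andP[].
  apply: (@negligibleS _ _ _ _ ([set w | V i0 w = H true s w] `|`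
      [set w | V i0 w = H false s w])).
    move=> w [_ [b]]; rewrite last_rcons -sk -cats1 take_size_cat//.
    by case: b; [left|right].
  by apply: negligibleU; apply: (negligible_eq_others hVunif hVindep); exact: mH.
apply: negligibleS (negligibleU negligible_out_range (negligible_seq nF)) => w /= Gw.
have [wI|wI] := pselect (in_range V L w); [right|by left].
have [s sp Us] := order_statistics_map w; exists s => //.
have ss : size s = k.
  by move: sp; rewrite mem_permutations => /perm_size ->; rewrite size_enum_ord.
have := sorted_order_statistics wI; rewrite Us.
move: Gw; rewrite /G Us.
case/lastP: s ss {sp Us} => [/= /esym k00|s i0 ss].
  by exfalso; move: (k0); rewrite k00.
have sk : size s = k.-1 by move: (congr1 predn ss); rewrite size_rcons.
have take_s : take k.-1 (rcons s i0) = s by rewrite -sk -cats1 take_size_cat.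
rewrite /F /= last_rcons take_s map_rcons.
rewrite -rcons_cons spacings_prod_rcons// -rcons_cons spacings_prod_rcons//.
rewrite /= last_rcons -/(K s w) -/(a s w) !rcons_path last_rcons.
move=> KG /andP[/andP[sV aV] VL]; split; first by case: (s).
have K0 : 0 < K s w.
  rewrite lt_neqAle eq_sym; apply/andP; split.
    by apply/eqP => Kw; move: KG c0; rewrite Kw !mul0r => <-; rewrite ltxx.
  rewrite /K /spacings_prod; apply: prodr_ge0 => i _; rewrite subr_ge0.
  apply: (sorted_leq_nth le_trans le_refl) => //; rewrite inE.
    by have := ltn_ord i; rewrite /=; lia.
  by have := ltn_ord i; rewrite /=; lia.
(* Completing the square: (2X - (a + L))^2 = (L - a)^2 - 4 (X - a)(L - X), where (X - a)(L - X) = c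
   / K. *)
have VH : (2 * V i0 w - (a s w + L)) ^+ 2 =
    (L - a s w) ^+ 2 - 4 * c * K s w `^ (-1).
  rewrite powRN powRr1 ?(ltW K0)// -KG; field; exact: lt0r_neq0.
have sqE : `|2 * V i0 w - (a s w + L)| =
    ((L - a s w) ^+ 2 - 4 * c * K s w `^ (-1)) `^ 2^-1.
  by rewrite -VH powR12_sqrt ?sqr_ge0// sqrtr_sqr.
have [h|h] := leP 0 (2 * V i0 w - (a s w + L)).
  by exists false; rewrite /H -sqE ger0_norm//; field.
by exists true; rewrite /H -sqE ltr0_norm//; field.
Qed.

Lemma measurable_spacings : measurable_fun setT G.
Proof.
by apply: measurable_order_statistics_spacings => i; exact: measurable_funPT.
Qed.

Lemma spacings_atomless c : (0 < k)%N -> Q [set w | G w = c] = 0%E.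
Proof.
move=> k0; apply: measure_negligible.
  rewrite -[X in measurable X]setTI.
  by have := measurable_spacings measurableT (measurable_set1 c).
have [c0|c0|->] := ltgtP c 0; last exact: negligible_spacings0.
  apply: negligibleS negligible_out_range => w /= Gw.
  move=> /sorted_order_statistics /spacings_prod_ge0.
  by rewrite -/(G w) Gw leNgt c0.
exact: negligible_spacings_pos.
Qed.

End uniform_spacings.

(** * Positivity on intervals *)

Lemma spacings_prod_cell_close (R : realType) (L : R) (m : nat) (x : seq R)
    (tau : seq 'I_m.+1) : 0 < L -> size x = size tau ->
  all (fun u => 0 <= u <= L) x ->
  (forall i, (i < size x)%N ->
    (nth ord0 tau i)%:R * L / m.+1%:R <= x`_i <=
    (nth ord0 tau i).+1%:R * L / m.+1%:R) ->
  `|spacings_prod (0 :: rcons x L) - spacings_prod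
    (0 :: rcons [seq j%:R * L / m.+1%:R | j : 'I_m.+1 <- tau] L)| <=
  (size x).+1%:R * (1 + L) ^+ (size x).+1 * (2 * (L / m.+1%:R)).
Proof.
move=> L0 xtau xL xcell; apply: spacings_prod_close => //.
- exact: ltW.
- by rewrite divr_ge0// ltW.
- by rewrite size_map.
- rewrite all_map; apply/allP => j _ /=.
  have -> /= : 0 <= j%:R * L / m.+1%:R by rewrite divr_ge0// mulr_ge0// ltW.
  by rewrite ler_pdivrMr// mulrC ler_pM2l// ler_nat; exact/ltnW/ltn_ord.
- move=> i ix; rewrite (nth_map ord0) -?xtau//.
  have /andP[h1 h2] := xcell i ix.
  rewrite ger0_norm ?subr_ge0// lerBlDr (le_trans h2)//.
  by rewrite -[(nth ord0 tau i).+1%:R]natr1 !mulrDl mul1r addrC.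
Qed.

Lemma exists_natdiv_lt (R : realType) (M e : R) : 0 < e ->
  exists m, M / m.+1%:R <= e.
Proof.
move=> e0; have [M0|M0] := leP M 0.
  by exists 0%N; rewrite divr1 (le_trans M0)// ltW.
have [n ne] := exists_natSinv_lt (divr_gt0 e0 M0).
by exists n; rewrite mulrC -ler_pdivlMr// ltW.
Qed.

Section positivity.
Context d (Omega : measurableType d) (R : realType) (Q : probability Omega R).
Variables (k : nat) (V : 'I_k -> {RV Q >-> R}) (L : R) (L0 : 0 < L).
Hypothesis hVunif : forall (i : 'I_k) (A : set R), measurable A ->
  distribution Q (V i) A = uniform_prob L0 A.
Hypothesis hVindep : mutually_independent Q (fun i => V i : Omega -> R).

Let U := order_statistics (fun i => V i : Omega -> R).
Let G w := spacings_prod (0 :: rcons (U w) L).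

(** The points s, 2s, ..., ks form a one-parameter family of configurations. As s runs from 0 to L /
    (k+1), the product runs continuously from 0 (when k > 0) to its maximum, so every admissible
    value is attained. *)
Lemma spacings_prod_mkseq (s : R) :
  spacings_prod (0 :: rcons (mkseq (fun i => i.+1%:R * s) k) L) =
  s ^+ k * (L - k%:R * s).
Proof.
rewrite spacings_prodE size_mkseq big_ord_recr/=; congr (_ * _).
  transitivity (\prod_(i < k) s); last by rewrite prodr_const card_ord.
  apply: eq_bigr => -[i ik] _ /=; rewrite nth_rcons size_mkseq ik nth_mkseq//.
  case: i ik => [|i] ik /=; first by rewrite subr0 mul1r.
  by rewrite nth_rcons size_mkseq ltnW// nth_mkseq 1?ltnW// -!natr1; ring.
rewrite nth_rcons size_mkseq ltnn eqxx; congr (_ - _).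
case: (k) => [|n]; first by rewrite /= mul0r.
rewrite -[LHS]/((rcons (mkseq (fun i => i.+1%:R * s) n.+1) L)`_n).
by rewrite nth_rcons size_mkseq ltnSn nth_mkseq.
Qed.

Lemma exists_spacings c : (0 < k)%N -> 0 < c -> c <= (L / k.+1%:R) ^+ k.+1 ->
  exists2 s : R, 0 < s <= L / k.+1%:R & s ^+ k * (L - k%:R * s) = c.
Proof.
move=> k0 c0 cL.
pose f (s : R) := s ^+ k * (L - k%:R * s).
have Lk : 0 <= L / k.+1%:R by rewrite divr_ge0 ?ltW.
have f0 : f 0 = 0 by rewrite /f expr0n gtn_eqF// mul0r.
have fL : f (L / k.+1%:R) = (L / k.+1%:R) ^+ k.+1.
  rewrite /f exprSr; congr (_ * _); rewrite -natr1; field.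
  by rewrite gt_eqF// ltr_wpDl.
have cf : {within `[0, L / k.+1%:R], continuous f}.
  apply: continuous_subspaceT => x; apply: cvgM; first exact: exprn_continuous.
  by apply: cvgB; [exact: cvg_cst|apply: cvgM; [exact: cvg_cst|exact: cvg_id]].
have cI : Num.min (f 0) (f (L / k.+1%:R)) <= c <= Num.max (f 0) (f (L / k.+1%:R)).
  by rewrite f0 fL ge_min le_max (ltW c0) cL orbT.
have [s + fs] := IVT Lk cf cI; rewrite in_itv/= => /andP[s0 sL].
exists s => //; rewrite sL andbT lt_neqAle s0 andbT.
by apply/eqP => s00; move: c0; rewrite -fs -s00 f0 ltxx.
Qed.

(** Take a configuration [x] whose product is the midpoint of ]a, b[. The sample falls in the same
    cells as [x] with positive probability, and on a fine grid this keeps the product inside the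
    interval. *)
Lemma spacings_positive (a b : R) : (0 < k)%N -> 0 <= a -> a < b ->
  b <= (L / k.+1%:R) ^+ k.+1 ->
  (0 < Q [set w | (a < G w < b)%R])%E.
Proof.
move=> k0 a0 ab bL.
have [||s /andP[s0 sL] sc] := @exists_spacings ((a + b) / 2) k0; [lra|lra|].
pose x := mkseq (fun i => i.+1%:R * s) k.
have kx : size x = k by rewrite size_mkseq.
have ksL : k.+1%:R * s <= L by rewrite mulrC -ler_pdivlMr.
have xL : all (fun u => 0 < u <= L) x.
  apply/(all_nthP 0) => i; rewrite kx => ik; rewrite nth_mkseq// mulr_gt0//=.
  by apply: le_trans ksL; rewrite ler_pM2r// ler_nat ltnW.
(* Both [x] and the sample are compared with the grid points, so the error counts twice: 2/5 of the
   length stays below the half-length of ]a, b[. *)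
have [m mM] := @exists_natdiv_lt _
  (k.+1%:R * (1 + L) ^+ k.+1 * (2 * L)) ((b - a) / 5) ltac:(lra).
pose t (j : nat) : R := j%:R * L / m.+1%:R.
pose tau := [seq cell t m u | u <- x].
have ktau : size tau = k by rewrite size_map kx.
have stau : sorted <=%O tau.
  apply: (homo_sorted (e := <=%R)) => [u v|]; first exact: cell_homo.
  apply/(sortedP 0) => i; rewrite kx => ik.
  by rewrite !nth_mkseq ?(ltnW ik)// ler_pM2r// ler_nat.
have tnd : {homo t : i j / (i <= j)%N >-> i <= j} by exact: grid_nd.
have close z : size z = k -> all (fun u => 0 < u <= L) z ->
    [seq cell t m u | u <- z] = tau ->
    `|spacings_prod (0 :: rcons z L) - spacings_prod
      (0 :: rcons [seq j%:R * L / m.+1%:R | j : 'I_m.+1 <- tau] L)| <= (b - a) / 5.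
  move=> kz zL ztau; apply: le_trans mM.
  have := @spacings_prod_cell_close _ L m z tau L0.
  rewrite kz ktau => /(_ erefl) h; rewrite -mulrA -(mulrA 2); apply: h.
    by apply: sub_all zL => u /andP[/ltW -> ->].
  move=> i ik; have zi := allP zL _ (mem_nth 0 (_ : (i < size z)%N)).
  have /zi : (i < size z)%N by rewrite kz.
  rewrite -(grid_itv L m) -ztau (nth_map 0) ?kz// => /(cell_in tnd).
  by move=> /andP[/ltW -> ->].
(* One labelled arrangement is enough for positivity; sorting then yields [tau]. *)
pose A := in_range V L `&` [set w | [seq cell t m (V i w) | i <- enum 'I_k] = tau].
have QA : (0 < Q A)%E.
  by rewrite /A (measure_sample_cell hVunif hVindep)// lte_fin.
apply: lt_le_trans QA _; apply: le_measure; rewrite ?inE.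
- exact: measurable_sample_cell.
- have mG := measurable_spacings V L.
  have := mG measurableT _ (measurable_itv `]a, b[); rewrite setTI.
  by congr measurable; apply/seteqP; split => w /=; rewrite in_itv.
- move=> w [wI /= wtau].
  have Utau : [seq cell t m u | u <- U w] = tau.
    apply/eqP; rewrite order_statistics_cellE// wtau mem_permutations.
    exact: perm_refl.
  have UL : all (fun u => 0 < u <= L) (U w).
    by rewrite all_sort all_map; apply/allP => i _ /=; move/in_rangeP : wI; apply.
  have h1 := close _ (size_order_statistics V w) UL Utau.
  have h2 := close _ kx xL erefl.
  move: h1 h2; rewrite spacings_prod_mkseq sc -/(G w) !ler_norml; lra.
Qed.

End positivity.

(** * The Poisson process *)

Section cumulative.
Context (R : realType) (T1 T2 : R) (lambda : R -> R).
Hypothesis hlambda : is_intensity T1 T2 lambda.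
Hypothesis hL : 0 < cumulative T1 lambda T2.
Let Lambda := cumulative T1 lambda.
Let L := Lambda T2.

Lemma cumulative_start : Lambda T1 = 0.
Proof. by rewrite /Lambda /cumulative set_itv1 Rintegral_set1. Qed.

Lemma cumulative_lt : T1 < T2.
Proof.
rewrite ltNge; apply/negP => T21; move: hL; rewrite /cumulative.
move: T21; rewrite le_eqVlt => /predU1P[->|T21].
  by rewrite set_itv1 Rintegral_set1 ltxx.
by rewrite set_itv_ge ?bnd_simp -?ltNge// Rintegral_set0 ltxx.
Qed.

Lemma cumulative_le a b : T1 <= a -> a <= b -> b <= T2 -> Lambda a <= Lambda b.
Proof.
move=> Ta ab bT; rewrite -subr_ge0 /Lambda /cumulative.
rewrite Rintegral_itvB ?bnd_simp//.
  apply: Rintegral_ge0 => x /=; rewrite in_itv/= => /andP[ax xb].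
  by apply hlambda.1; rewrite (le_trans Ta (ltW ax)) (le_trans xb bT).
apply: integrableS hlambda.2 => //.
by apply: subset_itvl; rewrite bnd_simp.
Qed.

Lemma cumulative_itv u : T1 <= u <= T2 -> 0 <= Lambda u <= L.
Proof.
by move=> /andP[Tu uT]; rewrite -[X in X <= _ <= _]cumulative_start !cumulative_le.
Qed.

Lemma cumulative_surj y : 0 <= y <= L -> exists2 x, T1 <= x <= T2 & Lambda x = y.
Proof.
move=> /andP[y0 yL]; have T12 := ltW cumulative_lt.
have cL := parameterized_integral_continuous T12 hlambda.2.
have [|x + Lx] := @IVT _ Lambda T1 T2 y T12 cL; last by rewrite in_itv/=; exists x.
by rewrite cumulative_start -/L ge_min y0 le_max yL orbT.
Qed.

(** The intermediate value theorem supplies preimages of the levels, and distinct levels force them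
    to be ordered. The two ends are imposed, since 0 and L may have other preimages and the cells
    must cover ]T1, T2]. Past index m+1 the sequence stays at T2, because [poisson_process] takes
    sequences indexed by all integers. *)
Lemma cumulative_grid m : exists t : nat -> R,
  [/\ {homo t : i j / (i <= j)%N >-> i <= j},
      t 0%N = T1, t m.+1 = T2 &
      forall j, T1 <= t j <= T2 /\ Lambda (t j) = (minn j m.+1)%:R * L / m.+1%:R].
Proof.
have T12 := cumulative_lt; have L0 : 0 < L := hL.
have h (j : nat) : exists y, [/\ T1 <= y <= T2,
    Lambda y = (minn j m.+1)%:R * L / m.+1%:R,
    (j = 0%N -> y = T1) & ((m.+1 <= j)%N -> y = T2)].
  case: j => [|j].
    by exists T1; split => //; rewrite ?lexx ?ltW// cumulative_start min0n !mul0r.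
  have [mj|jm] := leqP m.+1 j.+1.
    by exists T2; split => //; rewrite ?lexx ?ltW// mulrAC divff ?mul1r.
  have [|y yT Ly] := @cumulative_surj (j.+1%:R * L / m.+1%:R).
    rewrite divr_ge0 ?mulr_ge0//= ?(ltW L0)// ler_pdivrMr// mulrC ler_pM2l//.
    by rewrite ler_nat ltnW.
  by exists y; split => //; rewrite leqNgt jm.
have [t ht] := choice h; exists t; split.
- move=> i j ij.
  have [/andP[iT1 iT2] Li _ _] := ht i; have [/andP[jT1 jT2] Lj _ tj2] := ht j.
  have [mj|jm] := leqP m.+1 j; first by rewrite tj2.
  move: ij; rewrite leq_eqVlt => /predU1P[->//|ij].
  rewrite leNgt; apply/negP => ji.
  have := cumulative_le jT1 (ltW ji) iT2; rewrite Li Lj.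
  rewrite (minn_idPl (ltnW jm)) (minn_idPl (ltnW (ltn_trans ij jm))).
  by rewrite leNgt ltr_pM2r ?invr_gt0// ltr_pM2r// ltr_nat ij.
- by have [_ _ ->] := ht 0%N.
- by have [_ _ _ ->] := ht m.+1.
- by move=> j; have [? ? _ _] := ht j.
Qed.

End cumulative.

Lemma measure_setI_null d (T : measurableType d) (R : realType)
    (mu : {measure set T -> \bar R}) (A Z : set T) :
  measurable A -> measurable Z -> mu (~` Z) = 0%E -> mu (A `&` Z) = mu A.
Proof.
move=> mA mZ Z0; rewrite [RHS](measureDI mu mA mZ).
rewrite [X in _ = (X + _)%E](_ : _ = 0%E) ?add0e//.
apply: (subset_measure0 (B := ~` Z)) => //; first exact: measurableD.
  exact: measurableC.
Qed.

Section poisson.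
Context (R : realType) (T1 T2 : R) (lambda : R -> R).
Hypothesis hlambda : is_intensity T1 T2 lambda.
Hypothesis hL : 0 < cumulative T1 lambda T2.
Let Lambda := cumulative T1 lambda.
Let L := Lambda T2.
Context d (Omega : measurableType d) (P : probability Omega R).
Variables (S : Omega -> seq R).
Hypothesis hS : poisson_process T1 T2 P lambda S.

(** Encoded by a count, so that measurability is part of being a random spike train. On this event
    the counts over ]T1, T2] account for all of [S]. *)
Definition no_start := [set w | count (fun u => (u <= T1)%R) (S w) = 0%N].

Let hst w : spike_train T1 T2 (S w). Proof. by have [[]] := hS. Qed.

Let hcount u n : measurable [set w | count (fun v => (v <= u)%R) (S w) = n].
Proof. by have [[_]] := hS. Qed.

Let range_S w : all (fun u => T1 <= u <= T2) (S w).
Proof. by have /andP[] := hst w. Qed.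

Lemma no_startP w : no_start w <-> all (fun u => T1 < u <= T2) (S w).
Proof.
rewrite /no_start/=; split => [/eqP|allS].
  rewrite -leqn0 leqNgt -has_count -all_predC => allS.
  apply/allP => u uS; have /= := allP allS u uS; rewrite -ltNge => ->.
  by have /andP[] := allP (range_S w) u uS.
apply/eqP; rewrite -leqn0 leqNgt -has_count -all_predC.
by apply: sub_all allS => u /andP[Tu _] /=; rewrite -ltNge.
Qed.

Lemma measurable_no_start : measurable no_start.
Proof. exact: hcount. Qed.

Lemma no_start_null : P (~` no_start) = 0%E.
Proof.
have [_ + _ _] := hS => hT1.
apply: measure_negligible; first exact: measurableC measurable_no_start.
apply: negligibleS hT1 => w; apply: contra_not => /= T1S; apply/no_startP.
apply/allP => u uS; have /andP[Tu ->] := allP (range_S w) u uS.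
rewrite lt_neqAle Tu !andbT; apply/eqP => Tu'.
by move: T1S; rewrite Tu' uS.
Qed.

Lemma nb_eventsE w a b : a <= b -> (nb_events (S w) a b +
  count (fun u => (u <= a)%R) (S w) = count (fun u => (u <= b)%R) (S w))%N.
Proof.
move=> ab; rewrite /nb_events -count_predUI.
rewrite [X in (_ + X)%N](_ : _ = 0%N) ?addn0; last first.
  by apply/eqP; rewrite -leqn0 leqNgt -has_count; apply/hasPn => u _ /=;
    case: (ltP a u); rewrite /= ?andbF.
apply: eq_count => u /=; case: (leP u a) => ua; last by rewrite orbF.
by rewrite (le_trans ua ab).
Qed.

Lemma measurable_nb_events a b n : a <= b ->
  measurable [set w | nb_events (S w) a b = n].
Proof.
move=> ab; rewrite [X in measurable X](_ : _ = \bigcup_p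
    ([set w | count (fun u => (u <= a)%R) (S w) = p] `&`
     [set w | count (fun u => (u <= b)%R) (S w) = (n + p)%N])).
  by apply: bigcupT_measurable => p; exact: measurableI.
apply/seteqP; split => w /=.
  move=> wn; exists (count (fun u => u <= a) (S w)) => //.
  by rewrite /= -(nb_eventsE w ab) wn.
by move=> [p _ /= [pa]]; rewrite -(nb_eventsE w ab) pa => /addIn.
Qed.

Lemma poisson_prob1 (rate : R) n : 0 < rate ->
  poisson_prob rate 0 [set n] = (poisson_pmf rate n)%:E.
Proof.
by move=> r0; rewrite /poisson_prob r0 esum_set1// lee_fin poisson_pmf_ge0.
Qed.

Lemma measurable_size_eq k : measurable [set w | size (S w) = k].
Proof.
have := hcount T2 k; congr measurable; apply/seteqP; split => w /= <-; last first.
  by apply/eqP; rewrite -all_count; apply: sub_all (range_S w) => u /andP[].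
by apply/esym/eqP; rewrite -all_count; apply: sub_all (range_S w) => u /andP[].
Qed.

Lemma poisson_size k : P [set w | size (S w) = k] = (poisson_pmf L k)%:E.
Proof.
have T12 : T1 <= T2 := ltW (cumulative_lt hL).
rewrite -(measure_setI_null (measurable_size_eq k) measurable_no_start
  no_start_null).
rewrite -poisson_prob1//.
have [_ _ hp _] := hS; have := hp T1 T2 (lexx _) T12 (lexx _) [set k].
rewrite -/Lambda /Lambda cumulative_start subr0 => <-; rewrite /pushforward.
have mN := measurable_nb_events k T12.
rewrite -[RHS](measure_setI_null mN measurable_no_start no_start_null).
congr (P _); apply/seteqP; split => w /= [wk w0]; split => //;
  have := nb_eventsE w T12; rewrite w0 addn0 /preimage/=.
  by move=> ->; apply/eqP; rewrite -wk -all_count;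
    apply: sub_all (range_S w) => u /andP[].
by rewrite wk => ->; apply/esym/eqP; rewrite -all_count;
  apply: sub_all (range_S w) => u /andP[].
Qed.

End poisson.

(** The exponentials multiply to exp(-L), the powers of L / (m+1) add up to the total count, and the
    factorials combine into the number of distinct permutations: independent Poisson counts given
    their sum are multinomial. *)
Lemma prod_poisson_pmf (R : realType) (L : R) (m : nat) (tau : seq 'I_m.+1) :
  0 < L ->
  \prod_(j < m.+1) poisson_pmf (L / m.+1%:R) (count_mem j tau) =
  poisson_pmf L (size tau) *
    ((size (permutations tau))%:R * m.+1%:R^-1 ^+ size tau).
Proof.
move=> L0; have n0 : m.+1%:R != 0 :> R by rewrite pnatr_eq0.
have Ln0 : 0 < L / m.+1%:R by rewrite divr_gt0.
have fact_neq0 j : j`!%:R != 0 :> R by rewrite pnatr_eq0 -lt0n fact_gt0.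
under eq_bigr do rewrite /poisson_pmf Ln0.
rewrite /poisson_pmf L0 !big_split/= prodrXr.
have -> : (\sum_(j < m.+1) count_mem j tau)%N = size tau.
  rewrite -sum1_size [RHS](partition_big id xpredT)//=.
  by apply: eq_bigr => j _; rewrite sum1_count; apply: eq_count => i.
have -> : \prod_(i < m.+1) expR (- (L / m.+1%:R)) = expR (- L).
  rewrite prodr_const card_ord -expRM_natl; congr expR.
  by rewrite mulrN mulrC divfK.
rewrite prodfV -size_permutations_count natrM natr_prod exprMn exprVn.
have P0 : \prod_(x : 'I_m.+1) (count_mem x tau)`!%:R != 0 :> R.
  by apply/prodf_neq0.
have Q0 : (size (permutations tau))%:R != 0 :> R.
  have := size_permutations_count tau; rewrite pnatr_eq0.
  by case: eqP => // ->; rewrite mul0n => /esym/eqP; rewrite eqn0Ngt fact_gt0.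
by field; rewrite P0 Q0/= expf_neq0.
Qed.

(** * Equality of the laws of the two products of spacings *)

Section transfer.
Context (R : realType) (T1 T2 : R) (lambda : R -> R).
Hypothesis hlambda : is_intensity T1 T2 lambda.
Hypothesis hL : 0 < cumulative T1 lambda T2.
Let Lambda := cumulative T1 lambda.
Let L := Lambda T2.
Context d (Omega : measurableType d) (P : probability Omega R).
Variables (S : Omega -> seq R).
Hypothesis hS : poisson_process T1 T2 P lambda S.
Context d' (Omega' : measurableType d') (Q : probability Omega' R).
Variables (k : nat) (V : 'I_k -> {RV Q >-> R}).
Hypothesis hVunif : forall (i : 'I_k) (A : set R), measurable A ->
  distribution Q (V i) A = uniform_prob hL A.
Hypothesis hVindep : mutually_independent Q (fun i => V i : Omega' -> R).

Let U := order_statistics (fun i => V i : Omega' -> R).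
Let G w := spacings_prod (0 :: rcons (U w) L).
Let GS w := spacings_prod (0 :: rcons (map Lambda (S w)) L).
Let card_k := [set w | size (S w) = k].
Let B := card_k `&` no_start T1 S.

Let L0 : 0 < L. Proof. exact: hL. Qed.

Let spike w : spike_train T1 T2 (S w). Proof. by have [[]] := hS. Qed.

Let mB : measurable B.
Proof.
apply: measurableI; first exact: measurable_size_eq hS _.
exact: measurable_no_start hS.
Qed.

Let mcard : measurable card_k. Proof. exact: measurable_size_eq hS _. Qed.

Let range_S w : all (fun u => T1 <= u <= T2) (S w).
Proof. by have /andP[] := spike w. Qed.

Let range_LS w : all (fun u => 0 <= u <= L) (map Lambda (S w)).
Proof.
rewrite all_map; apply: sub_all (range_S w) => u /= uT.
exact: cumulative_itv.
Qed.

Lemma sorted_cumulative w : sorted <=%R (0 :: rcons (map Lambda (S w)) L).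
Proof.
apply: sorted_cons_rcons => //; first exact: ltW.
have /andP[sS _] := spike w.
apply: (homo_sorted_in (P := fun u => T1 <= u <= T2)) sS => //.
by move=> u v /andP[Tu _] /andP[_ vT] uv; exact: (cumulative_le hlambda).
Qed.

Lemma measurable_spacings_cumulative : measurable_fun card_k GS.
Proof.
(* Clamping to [T1, T2] makes the function nondecreasing on the whole line, hence measurable,
   without changing it at the points of [S]. *)
pose phi u := Lambda (Num.max T1 (Num.min u T2)).
have T12 := cumulative_lt hL.
have mphi : measurable_fun setT phi.
  apply: nondecreasing_measurable => // u v uv; apply: (cumulative_le hlambda).
  - by rewrite le_max lexx.
  - by rewrite ge_max !le_max lexx/= le_min !ge_min uv lexx !orbT.
  - by rewrite ge_max ge_min lexx orbT ltW.
apply: (eq_measurable_fun (fun w => spacings_prod (0 :: rcons (map phi (S w)) L))).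
  move=> w _; rewrite /GS; congr (spacings_prod (0 :: rcons _ L)).
  apply/eq_in_map => u /(allP (range_S w)) /andP[Tu uT].
  by rewrite /phi (min_idPl uT) (max_idPr Tu).
apply: (@measurable_spacings_prod _ _ R S _ _ card_k k) => //.
- by move=> w; have /andP[] := spike w.
- by move=> y n; have [[_]] := hS.
Qed.

Section discretization.
Variables (m : nat) (t : nat -> R).
Hypotheses (t_nd : {homo t : i j / (i <= j)%N >-> i <= j})
  (t0 : t 0%N = T1) (tm : t m.+1 = T2)
  (ht : forall j, T1 <= t j <= T2 /\
    Lambda (t j) = (minn j m.+1)%:R * L / m.+1%:R).

Lemma nb_events_cell w (j : 'I_m.+1) : no_start T1 S w ->
  nb_events (S w) (t j) (t j.+1) = count_mem j [seq cell t m u | u <- S w].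
Proof.
move=> /(no_startP hS) w0; rewrite /nb_events count_map; apply: eq_in_count => u uS.
by rewrite /= cellP// t0 tm; exact: allP w0 _ uS.
Qed.

Lemma sorted_cell_S w : sorted <=%O [seq cell t m u | u <- S w].
Proof.
have /andP[sS _] := spike w.
by apply: homo_sorted sS; exact: cell_homo.
Qed.

(** Two sorted lists with the same multiplicities are equal, so the list of cells is described by
    the counts alone, to which the Poisson hypotheses apply. *)
Lemma cell_S_eqE tau : sorted <=%O tau -> size tau = k ->
  B `&` [set w | [seq cell t m u | u <- S w] = tau] =
  (\bigcap_(j : 'I_m.+1)
    (fun w => nb_events (S w) (t j) (t j.+1)) @^-1` [set count_mem j tau])
  `&` no_start T1 S.
Proof.
move=> stau ktau; apply/seteqP; split => [w [[_ w0] /= wtau]|w [/= wj w0]].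
  by split => // j _ /=; rewrite nb_events_cell// wtau.
have wtau : [seq cell t m u | u <- S w] = tau.
  apply: (sorted_eq le_trans le_anti) => //; first exact: sorted_cell_S.
  apply/allP => j _ /=; rewrite -nb_events_cell//; apply/eqP.
  exact: wj j I.
by split => //; split => //; rewrite /card_k/= -ktau -wtau size_map.
Qed.

Lemma measurable_cell_S tau :
  measurable (B `&` [set w | [seq cell t m u | u <- S w] = tau]).
Proof.
have [stau|stau] := boolP (sorted <=%O tau); last first.
  rewrite [X in measurable X](_ : _ = set0)// -subset0 => w [_ /= wtau].
  by move: stau; rewrite -wtau sorted_cell_S.
have [ktau|ktau] := eqVneq (size tau) k; last first.
  rewrite [X in measurable X](_ : _ = set0)// -subset0 => w [[wk _] /= wtau].
  by move: ktau; rewrite -wtau size_map wk eqxx.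
rewrite cell_S_eqE//; apply: measurableI; last exact: measurable_no_start hS.
apply: fin_bigcap_measurable => // j _.
by apply: (measurable_nb_events hS); exact: t_nd.
Qed.

Lemma measure_cell_S tau : sorted <=%O tau -> size tau = k ->
  P (B `&` [set w | [seq cell t m u | u <- S w] = tau]) =
  (poisson_pmf L k * ((size (permutations tau))%:R * m.+1%:R^-1 ^+ k))%:E.
Proof.
move=> stau ktau; rewrite cell_S_eqE//.
rewrite measure_setI_null; [|
  apply: fin_bigcap_measurable => // j _;
    by apply: (measurable_nb_events hS); exact: t_nd|
  exact: measurable_no_start hS|exact: no_start_null hS].
have [_ _ hp hind] := hS.
apply: etrans (hind m.+1 t t_nd (fun i => (ht i).1)
  (fun j => [set count_mem j tau]) _) _ => //.
rewrite -ktau -prod_poisson_pmf// -prodEFin; apply: eq_bigr => j _.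
have [/andP[Tt _] Lt] := ht j; have [/andP[_ tT] Lt'] := ht j.+1.
have := hp _ _ Tt (t_nd (leqnSn j)) tT [set count_mem j tau].
rewrite -/Lambda Lt Lt' (minn_idPl (ltn_ord j)) (minn_idPl (ltnW (ltn_ord j))).
rewrite /pushforward => ->.
have -> : j.+1%:R * L / m.+1%:R - j%:R * L / m.+1%:R = L / m.+1%:R.
  by rewrite -[j.+1%:R]natr1 -mulrBl -mulrBl addrAC subrr add0r mul1r.
by rewrite poisson_prob1// divr_gt0.
Qed.

End discretization.

Lemma poisson_pmf_gt0 : 0 < poisson_pmf L k.
Proof.
by rewrite /poisson_pmf L0 mulr_gt0 ?expR_gt0// mulr_gt0 ?exprn_gt0//.
Qed.

(** Both approximations are the same function [gp] of a list of cells, namely the product of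
    spacings of their left ends. The lists come from the time grid [t] on one side and the uniform
    grid [g] on the other; [Lambda] sends the first grid to the second. *)
Lemma approx_laws (e : R) : 0 < e -> exists (H1 : Omega -> R) (H2 : Omega' -> R),
  [/\ forall w, B w -> `|GS w - H1 w| <= e,
      forall w, in_range V L w -> `|G w - H2 w| <= e &
      forall c,
        [/\ measurable (B `&` [set w | H1 w <= c]),
            measurable (in_range V L `&` [set w | H2 w <= c]) &
            P (B `&` [set w | H1 w <= c]) =
            ((poisson_pmf L k)%:E *
              Q (in_range V L `&` [set w | (H2 w <= c)%R]))%E]].
Proof.
move=> e0.
have [m mM] := @exists_natdiv_lt _ (k.+1%:R * (1 + L) ^+ k.+1 * (2 * L)) e e0.
have [t [t_nd t0 tm ht]] := cumulative_grid hlambda hL m.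
pose g (j : nat) : R := j%:R * L / m.+1%:R.
have g_nd : {homo g : i j / (i <= j)%N >-> i <= j} by exact: grid_nd.
pose gp (tau : seq 'I_m.+1) := spacings_prod
  (0 :: rcons [seq j%:R * L / m.+1%:R | j : 'I_m.+1 <- tau] L).
pose C1 w := [seq cell t m u | u <- S w].
pose C2 w := [seq cell g m u | u <- U w].
exists (gp \o C1), (gp \o C2).
have close x (tau : seq 'I_m.+1) : size x = k -> size tau = k ->
    all (fun u => 0 <= u <= L) x ->
    (forall i, (i < k)%N -> (nth ord0 tau i)%:R * L / m.+1%:R <= x`_i <=
      (nth ord0 tau i).+1%:R * L / m.+1%:R) ->
    `|spacings_prod (0 :: rcons x L) - gp tau| <= e.
  move=> kx ktau xL xtau; apply: le_trans mM.
  have := @spacings_prod_cell_close _ L m x tau L0.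
  by rewrite kx ktau => /(_ erefl xL xtau); rewrite -!mulrA.
split.
- move=> w [wk w0]; apply: close; rewrite ?size_map// => i ik.
  have iS : (i < size (S w))%N by rewrite wk.
  rewrite /C1 (nth_map 0)// (nth_map 0)//.
  have ui := mem_nth 0 iS.
  have /andP[] : t (cell t m (S w)`_i) < (S w)`_i <= t (cell t m (S w)`_i).+1.
    by apply: cell_in => //; rewrite t0 tm; move/(no_startP hS) : w0 => /allP; apply.
  set j := cell t m _ => tj jt.
  have [/andP[Tt _] Lt] := ht j; have [/andP[_ tT] Lt'] := ht j.+1.
  have /andP[TS ST] := allP (range_S w) _ ui.
  have := cumulative_le hlambda Tt (ltW tj) ST.
  have := cumulative_le hlambda TS jt tT.
  rewrite Lt Lt' (minn_idPl (ltn_ord j)) (minn_idPl (ltnW (ltn_ord j))).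
  by move=> -> ->.
- move=> w wI; apply: close; rewrite ?size_map ?size_order_statistics//.
    exact: order_statistics_in_range.
  move=> i ik; rewrite /C2 (nth_map 0) ?size_order_statistics//.
  have iU : (i < size (U w))%N by rewrite size_order_statistics.
  have /andP[/ltW] : g (cell g m (U w)`_i) < (U w)`_i <= g (cell g m (U w)`_i).+1.
    apply: cell_in => //; rewrite grid_itv.
    have : all (fun u => 0 < u <= L) (U w).
      by rewrite all_sort all_map; apply/allP => l _ /=; move/in_rangeP : wI; apply.
    by move/allP; apply; exact: mem_nth.
  by rewrite /g => -> ->.
move=> c.
(* Only finitely many lists of length [k] exist, so the event [gp <= c] is a finite disjoint union
   and the laws can be compared list by list. *)
pose s := [seq tau <- [seq val x | x <- enum {: k.-tuple 'I_m.+1}] | gp tau <= c].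
have us : uniq s by rewrite filter_uniq// map_inj_uniq ?enum_uniq//; exact: val_inj.
have sE (tau : seq 'I_m.+1) : size tau = k -> (tau \in s) = (gp tau <= c).
  move=> ktau; rewrite mem_filter; case: (gp tau <= c) => //=.
  have <- : val (Tuple (introT eqP ktau)) = tau by [].
  by rewrite mem_map ?mem_enum//; exact: val_inj.
have BE : B `&` [set w | (gp \o C1) w <= c] = B `&` [set w | C1 w \in s].
  by apply/seteqP; split => w [[wk w0] /= wc]; split => //=; move: wc;
    rewrite sE// size_map.
have IE : in_range V L `&` [set w | (gp \o C2) w <= c] =
    in_range V L `&` [set w | C2 w \in s].
  by apply/seteqP; split => w [wI /= wc]; split => //=; move: wc;
    rewrite sE// size_map size_order_statistics.
have m1 tau : measurable (B `&` [set w | C1 w = tau]) by exact: measurable_cell_S.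
have m2 tau : measurable (in_range V L `&` [set w | C2 w = tau]).
  exact: measurable_order_statistics_cell.
rewrite BE IE; split; [exact: measurable_seq_fibers|exact: measurable_seq_fibers|].
rewrite !measure_seq_fibers// ge0_sume_distrr//; apply: eq_big_seq => tau.
rewrite mem_filter => /andP[_ /mapP[x _ tauE]].
have ktau : size tau = k by rewrite tauE size_tuple.
(* An unsorted list is never attained on either side, so both masses are 0. *)
have [stau|stau] := boolP (sorted <=%O tau).
  apply: (etrans (measure_cell_S t_nd t0 tm ht stau ktau)).
  rewrite EFinM; congr (_ * _)%E; apply/esym.
  exact: (measure_order_statistics_cell hVunif hVindep).
rewrite (_ : _ `&` _ = set0) ?measure0; last first.
  by rewrite -subset0 => w [_ /= wtau]; move: stau; rewrite -wtau sorted_cell_S.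
rewrite [X in (_ * X)%E](_ : _ = 0%E) ?mule0//.
apply: (etrans (congr1 Q _) (measure0 Q)).
rewrite -subset0 => w [_ /= wtau]; move: stau; rewrite -wtau => /negP; apply.
have /= := sort_sorted (@le_total _ R) [seq V i w | i <- enum 'I_k].
by apply: homo_sorted; exact: cell_homo.
Qed.

Let mGS : measurable_fun B GS.
Proof.
by apply: measurable_funS measurable_spacings_cumulative => //; exact: subIsetl.
Qed.

Let mI : measurable (in_range V L). Proof. exact: measurable_in_range. Qed.

Let mG : measurable_fun setT G. Proof. exact: measurable_spacings. Qed.

Let to_B (A : set Omega) : measurable (card_k `&` A) ->
  P (card_k `&` A) = P (B `&` A).
Proof.
move=> mA; rewrite /B setIAC.
by rewrite (measure_setI_null mA (measurable_no_start hS) (no_start_null hS)).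
Qed.

Let to_range (A : set Omega') : measurable A ->
  Q A = Q (in_range V L `&` A).
Proof.
move=> mA; rewrite setIC measure_setI_null//.
exact: (out_range0 hVunif hVindep).
Qed.

Lemma measure_spacings_le c :
  fine (P ([set w | GS w <= c] `&` card_k)) / fine (P card_k) =
  dist_fun Q G c.
Proof.
rewrite setIC to_B; last exact: measurable_fun_leS measurable_spacings_cumulative _.
have mGc : measurable [set w | G w <= c].
  by rewrite -[X in measurable X]setTI; exact: measurable_fun_leS.
have -> : P (B `&` [set w | GS w <= c]) =
    ((poisson_pmf L k)%:E * Q [set w | (G w <= c)%R])%E.
  apply: etrans (eq_measure_le poisson_pmf_gt0 mB mI mGS _ approx_laws _) _.
    exact: measurable_funTS.
  by congr (_ * _)%E; exact/esym/to_range.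
rewrite (poisson_size hL hS) fineM ?fin_num_measure//.
by rewrite mulrAC divff ?mul1r// gt_eqF// poisson_pmf_gt0.
Qed.

Lemma measure_spacings_lt c :
  fine (P ([set w | GS w < c] `&` card_k)) / fine (P card_k) =
  fine (Q [set w | G w < c]).
Proof.
rewrite setIC to_B; last exact: measurable_fun_ltS measurable_spacings_cumulative _.
have mGc : measurable [set w | G w < c].
  by rewrite -[X in measurable X]setTI; exact: measurable_fun_ltS.
have -> : P (B `&` [set w | GS w < c]) =
    ((poisson_pmf L k)%:E * Q [set w | (G w < c)%R])%E.
  apply: etrans (eq_measure_lt poisson_pmf_gt0 mB mI mGS _ approx_laws _) _.
    exact: measurable_funTS.
  by congr (_ * _)%E; exact/esym/to_range.
rewrite (poisson_size hL hS) fineM ?fin_num_measure//.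
by rewrite mulrAC divff ?mul1r// gt_eqF// poisson_pmf_gt0.
Qed.

End transfer.

(** * Quantiles and thresholds *)

Lemma inf_min (R : realType) (E : set R) (x : R) : E x -> lbound E x -> inf E = x.
Proof.
move=> Ex lbx; apply/le_anti/andP; split; first by apply: ge_inf => //; exists x.
by apply: lb_le_inf => //; exists x.
Qed.

Section quantile.
Context d (T : measurableType d) (R : realType) (Q : probability T R).
Variables (G : T -> R) (p a b : R).
Hypotheses (mG : measurable_fun setT G) (p0 : 0 < p).
Hypotheses (Ga : dist_fun Q G a = 0) (Gb : p <= dist_fun Q G b).
Let F := dist_fun Q G.
Let C := quantile F p.

Let Fa : F a = 0. Proof. exact: Ga. Qed.

Let mle c : measurable [set w | G w <= c].
Proof. by rewrite -[X in measurable X]setTI; exact: measurable_fun_leS. Qed.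

Let mlt c : measurable [set w | G w < c].
Proof. by rewrite -[X in measurable X]setTI; exact: measurable_fun_ltS. Qed.

Lemma dist_fun_le : {homo F : x y / x <= y}.
Proof.
move=> x y xy; apply: fine_le; rewrite ?fin_num_measure//.
by apply: le_measure; rewrite ?inE// => w /= /le_trans; apply.
Qed.

Let lbE : lbound [set x | p <= F x] a.
Proof.
move=> x /= pF; rewrite leNgt; apply/negP => /ltW /dist_fun_le.
by rewrite leNgt Fa (lt_le_trans p0 pF).
Qed.

Let hasE : has_inf [set x | p <= F x].
Proof. by split; [exists b|exists a]. Qed.

Lemma quantile_le x : p <= F x -> C <= x.
Proof. by move=> pF; apply: ge_inf => //; exists a. Qed.

(** The infimum is attained because distribution functions are right-continuous. The points [a] and
    [b] make the set bounded below and nonempty, so that [inf] is a true infimum. *)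
Lemma dist_fun_quantile : p <= F C.
Proof.
rewrite -lee_fin /F /dist_fun fineK ?fin_num_measure//.
rewrite -[X in Q X]setTI; apply: (measure_le_lim measurableT mG) => e e0.
have [x /= pF xC] := inf_adherent e0 hasE.
rewrite setTI -[leRHS]fineK ?fin_num_measure// lee_fin.
by apply: le_trans pF _; apply: dist_fun_le; exact: ltW.
Qed.

Lemma quantile_gt : a < C.
Proof.
rewrite ltNge; apply/negP => /dist_fun_le; rewrite Fa => FC.
by have := dist_fun_quantile; rewrite leNgt (le_lt_trans FC p0).
Qed.

(** Below [C] every value of the distribution function is less than [p]; let the level increase to
    [C]. *)
Lemma measure_lt_quantile : fine (Q [set w | G w < C]) <= p.
Proof.
rewrite -lee_fin fineK ?fin_num_measure//.
have cv := @cvg_measure_lt _ _ _ Q _ _ measurableT mG C.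
rewrite -[X in Q X]setTI -(cvg_lim _ cv)//.
apply: lime_le; [exact: cvgP cv|apply: nearW => n].
rewrite setTI -[leLHS]fineK ?fin_num_measure// lee_fin.
rewrite leNgt; apply/negP => /ltW /quantile_le.
by rewrite leNgt ltrBlDr ltrDl invr_gt0 ltr0n.
Qed.

Lemma measure_lt_quantile_atomless :
  Q [set w | G w = C] = 0%E -> fine (Q [set w | G w < C]) = p.
Proof.
move=> QC; apply/le_anti; rewrite measure_lt_quantile/=.
apply: le_trans dist_fun_quantile _.
rewrite /F /dist_fun.
rewrite (_ : [set w | G w <= C] = [set w | G w < C] `|` [set w | G w = C]).
  rewrite measureU0//.
  rewrite -[X in measurable X]setTI.
  by have := mG measurableT (measurable_set1 C).
apply/seteqP; split => w /=; first by rewrite le_eqVlt => /predU1P[|]; [right|left].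
by case=> [/ltW//|->].
Qed.

(** If [u] exceeded [C], then P(G < u) would be at least F(C) + P(C < G < u), hence greater than
    [p]. *)
Lemma quantile_unique u : (C < u -> (0 < Q [set w | (C < G w < u)%R])%E) ->
  fine (Q [set w | G w < u]) = p -> u = C.
Proof.
move=> pos Gu.
have Cu : C <= u.
  apply: quantile_le; rewrite -Gu; apply: fine_le; rewrite ?fin_num_measure//.
  by apply: le_measure; rewrite ?inE// => w /=; exact: ltW.
apply/eqP; rewrite eq_le Cu andbT leNgt; apply/negP => ltCu.
have mCu : measurable [set w | C < G w < u].
  rewrite -[X in measurable X]setTI.
  have := mG measurableT (measurable_itv `]C, u[).
  by congr (measurable (_ `&` _)); apply/seteqP; split => w /=; rewrite in_itv.
have : fine (Q ([set w | G w <= C] `|` [set w | C < G w < u])) <= p.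
  rewrite -Gu; apply: fine_le; rewrite ?fin_num_measure//; first exact: measurableU.
  apply: le_measure; rewrite ?inE//; first exact: measurableU.
  by move=> w /= [/le_lt_trans|/andP[]//]; apply.
rewrite measureU//; last first.
  by rewrite -subset0 => w [/= GC /andP[]]; rewrite ltNge GC.
rewrite fineD ?fin_num_measure// leNgt => /negP; apply.
rewrite -[ltLHS]addr0 ler_ltD ?dist_fun_quantile//.
by apply: fine_gt0; rewrite pos//= ltey_eq fin_num_measure.
Qed.

End quantile.

(** * The depth as a function of the product of spacings *)

Section depth_of_spacings.
Context (R : realType) (kappa : R) (kappa0 : 0 < kappa).

(** The extended logarithm gives depth 0 at g = 0 and so keeps the function strictly increasing
    there; with ln 0 = 0 the value would be the maximal depth 1. *)
Definition depth_of (g : R) : R := fine ((1 - lne (kappa * g)%R%:E)^-1)%E.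

Lemma depth_of0 : depth_of 0 = 0.
Proof. by rewrite /depth_of mulr0 le0_lneNy. Qed.

Lemma depth_of_gt0E g : 0 < g -> depth_of g = (1 - ln (kappa * g))^-1.
Proof.
move=> g0; rewrite /depth_of lne_EFin ?mulr_gt0// -EFinB.
by rewrite fine_invr.
Qed.

Let ln_le1 g : 0 < g -> kappa * g <= 1 -> ln (kappa * g) <= 0.
Proof. by move=> g0 kg; exact: ln_le0. Qed.

Lemma depth_of_itv g : 0 < g -> kappa * g <= 1 -> 0 < depth_of g <= 1.
Proof.
move=> g0 kg; rewrite depth_of_gt0E//; have := ln_le1 g0 kg => h.
by rewrite invr_gt0 invf_le1; lra.
Qed.

Lemma depth_of_mono g u : 0 <= g -> kappa * g <= 1 -> 0 < u -> kappa * u <= 1 ->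
  (depth_of g <= depth_of u) = (g <= u).
Proof.
move=> + kg u0 ku; rewrite le_eqVlt => /predU1P[<-|g0].
  by rewrite depth_of0 (ltW u0) ltW//; have /andP[] := depth_of_itv u0 ku.
rewrite !depth_of_gt0E//; have h1 := ln_le1 g0 kg; have h2 := ln_le1 u0 ku.
rewrite lef_pV2 ?posrE; [|lra..].
by rewrite lerD2l lerN2 ler_ln ?posrE ?mulr_gt0// ler_pM2l.
Qed.

Lemma depth_of_mono_lt g u : 0 <= g -> kappa * g <= 1 -> 0 < u -> kappa * u <= 1 ->
  (depth_of g < depth_of u) = (g < u).
Proof.
move=> + kg u0 ku; rewrite le_eqVlt => /predU1P[<-|g0].
  by rewrite depth_of0 u0; have /andP[] := depth_of_itv u0 ku.
by rewrite ltNge depth_of_mono// -?ltNge// ltW.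
Qed.

(** The witness solves 1 / (1 - ln y) = x for y = kappa u, and y <= 1 amounts to x <= 1. *)
Lemma depth_of_surj x : 0 < x -> x <= 1 ->
  exists u, [/\ 0 < u, kappa * u <= 1 & depth_of u = x].
Proof.
move=> x0 x1; exists (expR (1 - x^-1) / kappa).
have E : kappa * (expR (1 - x^-1) / kappa) = expR (1 - x^-1).
  by rewrite mulrC divfK// gt_eqF.
have u0 : 0 < expR (1 - x^-1) / kappa by rewrite divr_gt0 ?expR_gt0.
split => //; first by rewrite E expR_le1 subr_le0 invf_ge1.
by rewrite depth_of_gt0E// E expRK opprB addrC subrK invrK.
Qed.

End depth_of_spacings.

(** The bound 1 on all depths makes the supremum an actual upper bound, so it is at least the
    positive depth of [k]. *)
Lemma norm_card_depth_gt0 (R : realType) d (Omega : measurableType d)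
    (P : probability Omega R) (N : Omega -> nat) (k : nat) :
  (forall n, measurable [set w | N w = n]) ->
  (0 < P [set w | N w = k])%E ->
  0 < norm_card_depth (pushforward P N) k.
Proof.
move=> mN Pk.
have mA (A : set nat) : measurable (N @^-1` A).
  rewrite (_ : N @^-1` A = \bigcup_(n in A) [set w | N w = n]).
    exact: bigcup_measurable.
  apply/seteqP; split => [w Aw|w [n An /= wn]]; first by exists (N w).
  by rewrite /preimage/= wn.
have gt0 (A : set nat) : A k -> 0 < fine (pushforward P N A).
  move=> Ak; apply: fine_gt0; rewrite /pushforward ltey_eq fin_num_measure// andbT.
  apply: lt_le_trans Pk _; apply: le_measure; rewrite ?inE//.
  by move=> w /= wk; rewrite /preimage/= wk.
have kd : 0 < card_depth (pushforward P N) k by rewrite lt_min !gt0//=.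
rewrite /norm_card_depth divr_gt0// (lt_le_trans kd)//.
apply: ub_le_sup; last by exists k.
exists 1 => _ [n _ <-]; rewrite ge_min; apply/orP; left.
rewrite -lee_fin fineK /pushforward ?fin_num_measure//.
exact: probability_le1.
Qed.

Section threshold.
Context (R : realType) (T1 T2 : R) (lambda : R -> R).
Hypothesis hlambda : is_intensity T1 T2 lambda.
Hypothesis hL : 0 < cumulative T1 lambda T2.
Let L := cumulative T1 lambda T2.
Variable k : nat.
Let kappa := (k.+1%:R / L) ^+ k.+1.

Lemma spacings_scale_gt0 : 0 < kappa.
Proof. by rewrite exprn_gt0// divr_gt0. Qed.

Lemma spacings_scaleV : (L / k.+1%:R) ^+ k.+1 = kappa^-1.
Proof. by rewrite /kappa -exprVn invf_div. Qed.

Lemma ilr_depthE (s : seq R) : size s = k ->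
  ilr_depth T1 T2 lambda s = depth_of kappa
    (spacings_prod (0 :: rcons (map (cumulative T1 lambda) s) L)).
Proof.
move=> sk; rewrite /ilr_depth /depth_of sk.
by rewrite /= map_rcons cumulative_start /kappa exprMn exprVn.
Qed.

End threshold.

(** For k = 0 the conditional law of the depth is a point mass and no [t] reaches [delta] exactly.
    Hence attainment is claimed for k > 0, uniqueness for every [k], and the quantile form gives
    [t_k] a meaning in all cases. *)
Theorem proposition1 (R : realType) (T1 T2 : R) (lambda : R -> R)
    (hlambda : is_intensity T1 T2 lambda)
    (d : measure_display) (Omega : measurableType d) (P : probability Omega R)
    (S : Omega -> seq R) (hS : poisson_process T1 T2 P lambda S)
    (delta : R) (hdelta : 0 < delta < 1) (r : R) (hr : 0 < r) (k : nat)
    (d' : measure_display) (Omega' : measurableType d')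
    (Q : probability Omega' R) (V : 'I_k -> {RV Q >-> R})
    (hL : 0 < cumulative T1 lambda T2)
    (hVunif : forall (i : 'I_k) (A : set R), measurable A ->
       distribution Q (V i) A = uniform_prob hL A)
    (hVindep : mutually_independent Q (fun i => V i : Omega' -> R)) :
  let L := cumulative T1 lambda T2 in
  let P_card := pushforward P (fun w => size (S w)) in
  let D := fun w => spike_train_depth T1 T2 lambda P_card r (S w) in
  let card_k := [set w | size (S w) = k] in
  let U := order_statistics (fun i => V i : Omega' -> R) in
  let G := fun w => spacings_prod (0 :: rcons (U w) L) in
  let C_k := quantile (dist_fun Q G) delta in
  let t_k := norm_card_depth P_card k `^ r /
             (1 - ln (C_k * (k.+1%:R / L) ^+ k.+1)) in
  [/\ forall t : R, cond_prob P [set w | D w < t] card_k = delta -> t = t_k,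
      (0 < k)%N -> cond_prob P [set w | D w < t_k] card_k = delta &
      quantile (fun t => cond_prob P [set w | D w <= t] card_k) delta = t_k].
Proof.
move=> L P_card D card_k U G C_k t_k.
have /andP[delta0 delta1] := hdelta.
pose W := norm_card_depth P_card k `^ r.
have mcard n : measurable [set w | size (S w) = n] by exact: measurable_size_eq hS n.
have Pk0 : (0 < P card_k)%E.
  by rewrite (poisson_size hL hS) lte_fin poisson_pmf_gt0.
have W0 : 0 < W by rewrite powR_gt0// norm_card_depth_gt0.
pose kappa := (k.+1%:R / L) ^+ k.+1.
have k0 : 0 < kappa := spacings_scale_gt0 hL k.
pose f := depth_of kappa.
pose GS w := spacings_prod (0 :: rcons (map (cumulative T1 lambda) (S w)) L).
have DE w : card_k w -> D w = W * f (GS w).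
  by move=> wk; rewrite /D /spike_train_depth wk (@ilr_depthE _ _ _ _ k _ wk).
have GSk w : card_k w -> 0 <= GS w /\ kappa * GS w <= 1.
  move=> wk; have sG := sorted_cumulative hlambda hL hS w; split.
    exact: spacings_prod_ge0 sG.
  rewrite -ler_pdivlMl// mulr1 -spacings_scaleV.
  by have := spacings_prod_le sG; rewrite size_map wk.
have mG : measurable_fun setT G by exact: measurable_spacings.
have mGle c : measurable [set w | G w <= c].
  by rewrite -[X in measurable X]setTI; exact: measurable_fun_leS.
(* With [Fmax], this places the quantile in ]0, 1 / kappa], where the depth is strictly increasing
   in the product. *)
have F0 : dist_fun Q G 0 = 0.
  rewrite /dist_fun (_ : Q _ = 0%E)//; apply: measure_negligible => //.
  have [kE|kpos] := posnP k.
    apply: negligibleS (@negligible_set0 _ _ _ Q) => w /=.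
    have : size (U w) = 0%N by rewrite size_order_statistics kE.
    move/size0nil; rewrite /G => ->; rewrite spacings_prodE/= big_ord1/= subr0.
    by rewrite leNgt hL.
  apply: negligibleS (negligibleU (negligible_out_range hVunif hVindep)
    (negligible_spacings0 hVunif hVindep kpos)) => w /= Gw.
  have [wI|wI] := pselect (in_range V L w); [right|by left].
  apply/le_anti; rewrite Gw/=; apply: spacings_prod_ge0.
  exact: sorted_order_statistics.
have Fmax : dist_fun Q G kappa^-1 = 1.
  rewrite /dist_fun (_ : Q _ = 1%E)//; apply/le_anti; rewrite probability_le1//=.
  rewrite -(in_range1 hVunif hVindep); apply: le_measure; rewrite ?inE//.
    exact: measurable_in_range.
  move=> w wI /=; rewrite -spacings_scaleV.
  have := spacings_prod_le (sorted_order_statistics hL wI).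
  by rewrite size_order_statistics.
have Fmax' : delta <= dist_fun Q G kappa^-1 by rewrite Fmax ltW.
have C0 : 0 < C_k := quantile_gt mG delta0 F0 Fmax'.
have C1 : kappa * C_k <= 1.
  by rewrite -ler_pdivlMl// mulr1; exact: (quantile_le mG delta0 F0 Fmax').
have t_kE : t_k = W * f C_k by rewrite /f depth_of_gt0E// [kappa * _]mulrC.
(* Any candidate threshold in ]0, W] is the scaled depth of some product [u], which turns events on
   [D] into events on [G]. *)
have surj t : 0 < t -> t <= W ->
    exists u, [/\ 0 < u, kappa * u <= 1 & t = W * f u].
  move=> t0 tW; have [||u [u0 u1 fu]] := @depth_of_surj _ _ k0 (t / W).
  - by rewrite divr_gt0.
  - by rewrite ler_pdivrMr// mul1r.
  by exists u; split => //; rewrite /f fu mulrC divfK// gt_eqF.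
have cond_lt u : 0 < u -> kappa * u <= 1 ->
    cond_prob P [set w | D w < W * f u] card_k = fine (Q [set w | G w < u]).
  move=> u0 u1; rewrite /cond_prob -(measure_spacings_lt hlambda hS hVunif hVindep).
  congr (fine (P _) / _); apply/seteqP; split => w /= [Dw wk]; split => //;
    have [G0 G1] := GSk w wk; move: Dw; by
    rewrite DE// ltr_pM2l// depth_of_mono_lt.
have cond_le u : 0 < u -> kappa * u <= 1 ->
    cond_prob P [set w | D w <= W * f u] card_k = dist_fun Q G u.
  move=> u0 u1; rewrite /cond_prob -(measure_spacings_le hlambda hS hVunif hVindep).
  congr (fine (P _) / _); apply/seteqP; split => w /= [Dw wk]; split => //;
    have [G0 G1] := GSk w wk; move: Dw; by
    rewrite DE// ler_pM2l// depth_of_mono.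
have D0 w : card_k w -> 0 <= D w.
  move=> wk; have [] := GSk w wk; rewrite DE// le_eqVlt => /predU1P[<- _|g0 g1].
    by rewrite /f depth_of0 mulr0.
  by have /andP[f0 _] := depth_of_itv k0 g0 g1; rewrite mulr_ge0// ltW.
have D1 w : card_k w -> D w <= W.
  move=> wk; have [] := GSk w wk; rewrite DE// le_eqVlt => /predU1P[<- _|g0 g1].
    by rewrite /f depth_of0 mulr0 ltW.
  by have /andP[_ f1] := depth_of_itv k0 g0 g1; rewrite ler_piMr// ltW.
have cond0 (A : set Omega) : A `&` card_k = set0 -> cond_prob P A card_k = 0.
  by move=> A0; rewrite /cond_prob A0 measure0 mul0r.
have fP : 0 < fine (P card_k).
  by apply: fine_gt0; rewrite Pk0/= ltey_eq fin_num_measure//; exact: (mcard k).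
split.
- move=> t tdelta.
  (* Since 0 <= D <= W, a threshold outside ]0, W] would give probability 0 or 1, and [delta] is
     neither. *)
  have t0 : 0 < t.
    rewrite ltNge; apply/negP => t0; move: tdelta delta0; rewrite cond0.
      by move=> <-; rewrite ltxx.
    rewrite -subset0 => w [/= Dt wk].
    by have := D0 w wk; rewrite leNgt (lt_le_trans Dt t0).
  have tW : t <= W.
    rewrite leNgt; apply/negP => Wt; move: tdelta delta1; rewrite /cond_prob.
    rewrite (_ : _ `&` _ = card_k) ?divff ?gt_eqF//.
      by move=> <-; rewrite ltxx.
    apply/seteqP; split => [w []//|w wk]; split => //=.
    exact: le_lt_trans (D1 w wk) Wt.
  have [u [u0 u1 tE]] := surj t t0 tW.
  rewrite tE t_kE; congr (_ * f _).
  apply: (quantile_unique mG delta0 F0 Fmax'); last by rewrite -cond_lt// -tE.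
  (* For k = 0 the product is always L and u <= L, so P(G < u) = 0, which contradicts the choice of
     [t]. *)
  move=> Cu; have [kE|kpos] := posnP k; last first.
    apply: (spacings_positive hVunif hVindep kpos (ltW C0) Cu).
    by rewrite spacings_scaleV -ler_pdivlMl// mulr1 in u1 *.
  have GL w : G w = L.
    have : size (U w) = 0%N by rewrite size_order_statistics kE.
    by move/size0nil; rewrite /G => ->; rewrite spacings_prodE/= big_ord1/= subr0.
  have uL : u <= L.
    move: u1; rewrite -ler_pdivlMl// mulr1 -spacings_scaleV kE.
    by rewrite divr1 expr1.
  have : fine (Q [set w | G w < u]) = 0.
    rewrite (_ : [set w | G w < u] = set0) ?measure0//.
    by rewrite -subset0 => w /=; rewrite GL ltNge uL.
  by rewrite -cond_lt// -tE tdelta => d0; move: delta0; rewrite d0 ltxx.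
- move=> kpos; rewrite t_kE cond_lt//.
  apply: (measure_lt_quantile_atomless mG delta0 F0 Fmax').
  exact: (spacings_atomless hVunif hVindep).
- apply: inf_min => /=.
    by rewrite t_kE cond_le//; exact: (dist_fun_quantile mG delta0 F0 Fmax').
  move=> t /= tdelta; have [Wt|tW] := ltP W t.
    apply: le_trans (ltW Wt); rewrite t_kE.
    by have /andP[_ f1] := depth_of_itv k0 C0 C1; rewrite ler_piMr// ltW.
  have [t0|t0] := ltP 0 t.
    have [u [u0 u1 tE]] := surj t t0 tW.
    rewrite tE t_kE ler_pM2l// depth_of_mono// ?(ltW C0)//.
    by apply: (quantile_le mG delta0 F0); rewrite -cond_le// -tE.
  (* For t = 0 the event is not empty in general: D = 0 exactly when the product vanishes, and this
     has probability F(0) = 0. *)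
  have : cond_prob P [set w | D w <= t] card_k = 0.
    move: t0; rewrite le_eqVlt => /predU1P[->|t0]; last first.
      apply: cond0; rewrite -subset0 => w [/= Dt wk].
      by have := D0 w wk; rewrite leNgt (le_lt_trans Dt t0).
    apply: etrans F0.
    rewrite -(measure_spacings_le hlambda hS hVunif hVindep) /cond_prob.
    congr (fine (P _) / _); apply/seteqP; split => w /= [Dw wk]; split => //;
      have [G0 G1] := GSk w wk.
      rewrite leNgt; apply/negP => g0; have /andP[f0 _] := depth_of_itv k0 g0 G1.
      by have := mulr_gt0 W0 f0; rewrite ltNge -/(f _) -DE// Dw.
    rewrite DE// (_ : GS w = 0) /f ?depth_of0 ?mulr0//.
    by apply/le_anti; rewrite G0 Dw.
  by move=> c0; move: (lt_le_trans delta0 tdelta); rewrite c0 ltxx.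
Qed.
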